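(* Let $\mathrm{im}(\lambda)\subseteq(0,1]$ be the set of all values $\lambda(\alpha)$, where $\alpha$ ranges over all automorphisms of all finite groups. Set $$\rho_0:=\frac45\cdot\prod_{p}\Bigl(1-\frac{1}{2^p}\Bigr)=0.504307524\ldots$$ and $$\rho_1:=\frac89\cdot\prod_{n\in\{3,5,8,49\}}\Bigl(1-\frac{1}{2^n}\Bigr)\cdot\prod_{p\geq11}\Bigl(1-\frac{1}{2^p}\Bigr)=0.750063685\ldots,$$ where in both cases the index $p$ runs over primes. Then the following hold: (1) For all $\rho\in\mathrm{im}(\lambda)$ there exists a sequence $((G_n,\alpha_n))_{n\geq0}$ of pairs consisting of a finite group $G_n$ and an automorphism $\alpha_n$ of $G_n$ such that $\lambda(\alpha_n)<\rho$ for all $n\in\mathbb{N}$ and $\lim_{n\to\infty}\lambda(\alpha_n)=\rho$. In particular, $\mathrm{im}(\lambda)$ has no isolated points. (2) $\mathrm{im}(\lambda)\cap(\frac12,\rho_0]=\emptyset$ (in particular, $\mathrm{im}(\lambda)$ is not dense in $(0,1]$), and $\inf(\mathrm{im}(\lambda)\cap(\rho_0,1))=\rho_0$ (in particular, $\mathrm{im}(\lambda)$ is not closed in $(0,1]$). (3) $\mathrm{im}(\lambda)\cap(\frac34,\rho_1]=\emptyset$ and $\inf(\mathrm{im}(\lambda)\cap(\rho_1,1))=\rho_1$.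
   Context: For a permutation $\psi$ of a finite set $X$, $\Lambda(\psi)$ denotes the largest length of a cycle of $\psi$ (fixed points count as cycles of length $1$), and $\lambda(\psi):=\frac{1}{|X|}\Lambda(\psi)$. This is applied to automorphisms of finite groups, viewed as permutations of the group. *)

(* Defs.v *)
From HB Require Import structures.
From mathcomp Require Import all_boot all_order all_algebra all_fingroup.
From mathcomp Require Import all_classical all_reals all_analysis.

Set Implicit Arguments.
Unset Strict Implicit.
Unset Printing Implicit Defensive.

Import Order.TTheory GRing.Theory Num.Theory.
Import numFieldNormedType.Exports.

Local Open Scope classical_set_scope.
Local Open Scope ring_scope.

(* [porbits psi] is the set of supports of the cycles of [psi], fixed points
   included. *)
Definition max_cycle_length (X : finType) (psi : {perm X}) : nat :=
  \max_(C in porbits psi) #|C|.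

Definition cycle_ratio (R : realType) (X : finType) (psi : {perm X}) : R :=
  (max_cycle_length psi)%:R / #|X|%:R.

Definition im_cycle_ratio (R : realType) : set R :=
  [set r | exists gT : finGroupType, exists2 alpha : {perm gT},
     alpha \in Aut [set: gT]%G & r = cycle_ratio R alpha].
Arguments im_cycle_ratio R : clear implicits.

(* The infinite product over the primes p >= m; the partial products decrease
   and are bounded below by 0, so the limit exists. *)
Definition prime_prod (R : realType) (m : nat) : R :=
  limn (fun N : nat => \prod_(m <= p < N | prime p) (1 - 1 / 2 ^+ p) : R).

Definition rho0 (R : realType) : R := 4 / 5 * prime_prod R 0.

Definition rho1 (R : realType) : R :=
  8 / 9 * (\prod_(n <- [:: 3; 5; 8; 49]%N) (1 - 1 / 2 ^+ n))
        * prime_prod R 11.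

(* [U] is closed in the subspace topology of [A]. *)
Definition closed_in (T : topologicalType) (A U : set T) : Prop :=
  closed (U : set (subspace A)).

(* Main.v *)
(** If an automorphism [a] of [G] has a cycle [C] with [#|G| < 2 #|C|], then
    [C^-1] is again a cycle of that length, so [C^-1 = C] and some power [b] of
    [a] inverts [C].  Since [C C^-1 = G], an abelian normal invariant subgroup
    is central.  By induction either [G / Z(G)] is abelian or [Z(G) = 1], and
    in the latter case counting the cosets of an abelian subgroup inverted by
    [b] bounds that subgroup by 3; both ways [G] turns out abelian.

    For abelian [G], every element has the form [(a^i - a^j) x] with [x] in
    [C], so [G] is a cyclic module over a commutative ring: [C] is the
    complement of the union of the maximal invariant subgroups, these are
    independent, and the ratio is the product of the factors [1 - 1 / q] over
    their indices [q].  The [q] are prime powers greater than 2 and the numbers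
    [q - 1] are pairwise coprime, so at most one [q] is odd and the others are
    [2 ^ m] with pairwise coprime exponents [m].  Conversely, multiplication by
    generators of the unit groups of finite fields realizes all such products.

    Pairwise coprime exponents have distinct least prime factors, so a product
    of factors [1 - 1 / 2 ^ m] is bounded below by the product over primes with
    a few small primes adjusted; comparing the finitely many adjustments yields
    the two gaps. *)
Require Import Defs.
From HB Require Import structures.
From mathcomp Require Import all_boot all_order all_algebra all_fingroup.
From mathcomp Require Import all_solvable all_field.
From mathcomp Require Import zify ring lra.

Set Implicit Arguments.
Unset Strict Implicit.
Unset Printing Implicit Defensive.

Import Order.TTheory GRing.Theory Num.Theory.

(** * Automorphisms with a cycle covering more than half of the group *)

Section LargeCycles.

Local Open Scope group_scope.

Lemma porbit_imset (T T' : finType) (a : {perm T}) (b : {perm T'}) (f : T -> T') x :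
  (forall u, f (a u) = b (f u)) -> porbit b (f x) = f @: porbit a x.
Proof.
move=> fab.
have fabX i u : f ((a ^+ i) u) = (b ^+ i) (f u).
  by elim: i => [|i IHi]; rewrite ?perm1 // !expgSr !permM fab IHi.
apply/setP => y; apply/porbitP/imsetP => [[i ->]|[u /porbitP[i ->] ->]].
  by exists ((a ^+ i) x); rewrite ?mem_porbit.
by exists i.
Qed.

Lemma card_porbit_comm (T : finType) (a : {perm T}) (f : T -> T) x :
  injective f -> (forall u, f (a u) = a (f u)) -> #|porbit a (f x)| = #|porbit a x|.
Proof. by move=> fI fa; rewrite (porbit_imset _ fa) card_imset. Qed.

Lemma ltn_card_meet (T : finType) (A B : {set T}) :
  #|T| < #|A| + #|B| -> exists2 y, y \in A & y \in B.
Proof.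
move=> ltT; suff /set0Pn[y /setIP[]] : A :&: B != set0 by exists y.
apply: contraTneq ltT => AB0; rewrite -leqNgt -cardsUI AB0 cards0 addn0.
exact: max_card.
Qed.

Lemma subgroup_half (gT : finGroupType) (H K : {group gT}) :
  H \subset K -> #|K| < 2 * #|H| -> H :=: K.
Proof.
move=> sHK ltK; apply/eqP; rewrite eqEcard sHK -(Lagrange sHK) /=.
have := Lagrange sHK; case: #|K : H| => [|[|n]] eqK; rewrite ?muln1 //; nia.
Qed.

Definition large_orbit (T : finType) (a : {perm T}) x := #|T| < 2 * #|porbit a x|.

(** * Translates and inverses of a large cycle *)

Section LargeOrbit.

Variables (gT : finGroupType) (a : {perm gT}).

(** Two sets that each cover more than half of the group meet, and cycles that meet are equal. *)
Lemma large_orbit_mem x y :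
  large_orbit a x -> #|porbit a y| = #|porbit a x| -> y \in porbit a x.
Proof.
rewrite /large_orbit => Lx Lyx.
have [|z zx zy] := @ltn_card_meet _ (porbit a x) (porbit a y); first by rewrite Lyx addnn -mul2n.
by rewrite -eq_porbit_mem in zx; rewrite -(eqP zx) porbit_sym.
Qed.

Lemma large_orbit_porbit x y : large_orbit a x -> y \in porbit a x -> large_orbit a y.
Proof. by rewrite -eq_porbit_mem /large_orbit => ? /eqP->. Qed.

(** The cycle and its left translate by [g] each cover more than half of the group, so they meet. *)
Lemma large_orbit_mulV x g : large_orbit a x ->
  exists i j, g = (a ^+ i) x * ((a ^+ j) x)^-1.
Proof.
rewrite /large_orbit => Lx.
have [|_ /porbitP[i ->] /lcosetP[_ /porbitP[j ->] eqg]] :=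
  @ltn_card_meet _ (porbit a x) (g *: porbit a x).
  by rewrite card_lcoset addnn -mul2n.
by exists i, j; rewrite eqg mulgK.
Qed.

Lemma large_orbit_sub x (H : {group gT}) :
  large_orbit a x -> porbit a x \subset H -> forall g, g \in H.
Proof.
move=> Lx sCH g; have [i [j ->]] := large_orbit_mulV g Lx.
by rewrite groupM ?groupV // (subsetP sCH) ?mem_porbit.
Qed.

Hypothesis aM : {morph a : u v / u * v}.

Lemma autXM i : {morph a ^+ i : u v / u * v}.
Proof.
elim: i => [|i IHi] u v; first by rewrite !perm1.
by rewrite !expgSr !permM IHi aM.
Qed.

Lemma aut1 : a 1 = 1.
Proof. by apply: (mulgI (a 1)); rewrite -aM !mulg1. Qed.

Lemma autX1 i : (a ^+ i) 1 = 1.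
Proof. by rewrite permX_fix ?aut1. Qed.

Lemma autV u : a u^-1 = (a u)^-1.
Proof. by apply: (mulgI (a u)); rewrite -aM !mulgV aut1. Qed.

Lemma autXV i u : (a ^+ i) u^-1 = ((a ^+ i) u)^-1.
Proof. by elim: i u => [|i IHi] u; rewrite ?perm1 // !expgSr !permM IHi autV. Qed.

Lemma large_orbitV x : large_orbit a x -> x^-1 \in porbit a x.
Proof.
by move=> Lx; apply: large_orbit_mem => //; apply: card_porbit_comm;
  [apply: invg_inj | move=> u; rewrite autV].
Qed.

(** A power of [a] taking [x] to its inverse inverts the whole cycle, because it commutes with every
    other power of [a]. *)
Lemma large_orbit_inverter x : large_orbit a x ->
  exists j, forall y, y \in porbit a x -> (a ^+ j) y = y^-1.
Proof.
move=> Lx; have /porbitP[j xV] := large_orbitV Lx.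
by exists j => _ /porbitP[i ->]; rewrite -permM -expgD addnC expgD permM -xV autXV.
Qed.

(** Being injective, [a] permutes the finite set [N], so no point outside [N] is mapped into it. *)
Lemma invariant_mem (N : {group gT}) u :
  {in N, forall u, a u \in N} -> (a u \in N) = (u \in N).
Proof.
move=> aN; have eqN : a @: N = N.
  apply/eqP; rewrite eqEcard card_imset ?leqnn ?andbT; last exact: perm_inj.
  by apply/subsetP=> _ /imsetP[v vN ->]; apply: aN.
by rewrite -{1}eqN mem_imset //; apply: perm_inj.
Qed.

Lemma invariantX_mem (N : {group gT}) i u :
  {in N, forall u, a u \in N} -> ((a ^+ i) u \in N) = (u \in N).
Proof. by move=> aN; elim: i => [|i IHi]; rewrite ?perm1 // expgSr permM invariant_mem. Qed.

(** * Quotients by invariant normal subgroups *)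

Section Quotient.

Variable N : {group gT}.
Hypotheses (nN : [set: gT] \subset 'N(N)) (aN : {in N, forall u, a u \in N}).

Lemma normT u : u \in 'N(N).
Proof. exact: (subsetP nN). Qed.

Lemma cosetTM : {morph coset N : u v / u * v}.
Proof. by move=> u v; rewrite coset_morphM // normT. Qed.

Lemma coset_eqT u v : (coset N u == coset N v) = (u^-1 * v \in N).
Proof.
rewrite -mem_lcoset -norm_rlcoset ?normT // eq_sym.
by apply/eqP/rcoset_kercosetP; rewrite ?normT.
Qed.

Lemma quotient_perm : exists2 b : {perm coset_of N},
  {morph b : u v / u * v} & forall u, coset N (a u) = b (coset N u).
Proof.
pose f (c : coset_of N) := coset N (a (repr c)).
have fE u : f (coset N u) = coset N (a u).
  apply/eqP; rewrite coset_eqT -autV -aM aN // -coset_eqT coset_reprK //.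
have fI : injective f.
  move=> c d /eqP; rewrite coset_eqT -autV -aM invariant_mem // -coset_eqT !coset_reprK.
  by move/eqP.
exists (perm fI) => [c d|u]; rewrite !permE ?fE //.
by rewrite -[c]coset_reprK -[d]coset_reprK -cosetTM !fE aM cosetTM.
Qed.

Lemma card_coset_of : (#|{: coset_of N}| * #|N| = #|gT|)%N.
Proof.
rewrite -!cardsT -[in LHS](quotientT N) card_quotient // mulnC Lagrange ?subsetT //.
Qed.

(** Each coset contains at most [#|N|] points of the cycle, so the image of the cycle fills more
    than half of the quotient. *)
Lemma large_orbit_quotient (b : {perm coset_of N}) x :
  (forall u, coset N (a u) = b (coset N u)) ->
  large_orbit a x -> large_orbit b (coset N x).
Proof.
move=> abE; rewrite /large_orbit (porbit_imset _ abE) -card_coset_of => Lx.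
suff le : #|porbit a x| <= #|coset N @: porbit a x| * #|N|.
  by rewrite -(ltn_pmul2r (cardG_gt0 N)) (leq_trans Lx) // -mulnA leq_mul2l.
rewrite -sum1_card (partition_big_imset (coset N)) /= -sum_nat_const.
apply: leq_sum => _ /imsetP[u _ ->]; rewrite sum1dep_card -(card_lcoset N u).
apply: subset_leq_card; apply/subsetP => v; rewrite inE mem_lcoset.
by rewrite [_ == _]eq_sym coset_eqT => /andP[].
Qed.

(** Powers of [a] carry the points of the cycle in one coset of [N] to those in another, so no coset
    contains more of them than the coset of [x]. Averaging over the cosets gives the bound. *)
Lemma large_orbit_fiber x : large_orbit a x ->
  #|N| < 2 * #|[set n in N | x * n \in porbit a x]|.
Proof.
rewrite /large_orbit -card_coset_of; set F := [set n in N | _] => Lx.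
suff le : #|porbit a x| <= #|{: coset_of N}| * #|F|.
  have /ltn_pmul2l <- : 0 < #|{: coset_of N}| by apply/card_gt0P; exists 1.
  by rewrite (leq_trans Lx) // mulnCA leq_mul2l.
rewrite -sum1_card (partition_big_imset (coset N)) /=.
apply: (@leq_trans (\sum_(i in coset N @: porbit a x) #|F|)); last first.
  by rewrite sum_nat_const leq_mul2r max_card orbT.
apply: leq_sum => _ /imsetP[_ /porbitP[i ->] ->]; rewrite sum1dep_card.
apply: (leq_trans _ (leq_imset_card (fun n => (a ^+ i) (x * n)) F)).
apply: subset_leq_card; apply/subsetP => v; rewrite inE eq_sym coset_eqT => /andP[vC vN].
have [w vE] : exists w, v = (a ^+ i) w by exists ((a ^+ i)^-1 v); rewrite permKV.
apply/imsetP; exists (x^-1 * w); last by rewrite mulKVg.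
rewrite inE mulKVg; move: vC vN; rewrite vE => vC vN; apply/andP; split; last first.
  by rewrite -eq_porbit_mem -(porbit_perm _ i w) eq_porbit_mem.
by rewrite -(invariantX_mem i _ aN) autXM // autXV.
Qed.

End Quotient.

End LargeOrbit.

Lemma dvdn_card_porbit (T : finType) (a : {perm T}) x n :
  ((a ^+ n) x == x) = (#|porbit a x| %| n).
Proof.
have fixM k : (a ^+ (k * #|porbit a x|)) x = x.
  by elim: k => [|k IHk]; rewrite ?perm1 // mulSn expgD permM [(a ^+ #|_|) x]permX iter_porbit.
apply/eqP/idP => [|/dvdnP[k ->]]; last exact: fixM.
rewrite {1}(divn_eq n #|porbit a x|) expgD permM fixM => fix_r.
have d_gt0 : 0 < #|porbit a x| by rewrite lt0n card_porbit_neq0.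
have lt_r := ltn_pmod n d_gt0; rewrite /dvdn.
have := uniq_traject_porbit a x => /(nth_uniq x) <-; rewrite ?size_traject //.
by rewrite !nth_traject // -permX fix_r.
Qed.

(** * Endomorphisms that are differences of powers *)

Section DifferencesOfPowers.

Variables (gT : finGroupType) (a : {perm gT}).
Hypotheses (aM : {morph a : u v / u * v}) (cT : forall u v : gT, u * v = v * u).

(* When [a] has a cycle on more than half of the group, these maps form the
   commutative ring of endomorphisms generated by [a]. *)
Definition pow_diff i j (u : gT) := (a ^+ i) u * ((a ^+ j) u)^-1.

Lemma pow_diffM i j : {morph pow_diff i j : u v / u * v}.
Proof.
move=> u v; rewrite /pow_diff !autXM // invMg -!mulgA; congr (_ * _).
by rewrite [LHS]mulgA [LHS]cT.
Qed.

Lemma pow_diff_comm i j u : pow_diff i j (a u) = a (pow_diff i j u).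
Proof. by rewrite /pow_diff aM autV // -!permM -expgSr -expgS -expgSr -expgS. Qed.

Lemma pow_diff_invariant i j (M : {group gT}) :
  {in M, forall u, a u \in M} -> {in M, forall u, pow_diff i j u \in M}.
Proof. by move=> aN u uM; rewrite /pow_diff groupM ?groupV ?invariantX_mem. Qed.

Lemma pow_diff_pre_group_set i j (M : {group gT}) :
  group_set [set u | pow_diff i j u \in M].
Proof.
apply/group_setP; split=> [|u v]; rewrite !inE.
  by rewrite /pow_diff !autX1 // invg1 mulg1.
by move=> uM vM; rewrite pow_diffM groupM.
Qed.
Canonical pow_diff_pre_group i j M := Group (pow_diff_pre_group_set i j M).

Lemma pow_diff_im_group_set i j : group_set [set pow_diff i j u | u in [set: gT]].
Proof.
apply/group_setP; split=> [|_ _ /imsetP[u _ ->] /imsetP[v _ ->]].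
  apply/imsetP; exists 1 => //.
  by rewrite /pow_diff !autX1 // invg1 mulg1.
by rewrite -pow_diffM imset_f.
Qed.
Canonical pow_diff_im_group i j := Group (pow_diff_im_group_set i j).

End DifferencesOfPowers.

(** * Maximal invariant subgroups of an abelian group *)

Section MaximalInvariant.

Variables (gT : finGroupType) (a : {perm gT}).

Definition max_invariant : {set {group gT}} :=
  [set M : {group gT} |
    maxgroup M (fun M : {group gT} => (M \proper [set: gT]) && (a @: M \subset M))].

Lemma invariantP (M : {set gT}) :
  reflect {in M, forall u, a u \in M} (a @: M \subset M).
Proof.
apply: (iffP subsetP) => aM u; last by case/imsetP=> v vM ->; apply: aM.
by move=> uM; rewrite aM // imset_f.
Qed.

Lemma max_invariantP (M : {group gT}) : M \in max_invariant ->
  [/\ exists u, u \notin M, {in M, forall u, a u \in M} &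
      forall H : {group gT}, {in H, forall u, a u \in H} -> M \subset H ->
      (exists2 u, u \in H & u \notin M) -> forall u, u \in H].
Proof.
rewrite inE => /maxgroupP[/andP[/properP[_ [u _ uM]] /invariantP aM] maxM].
split=> [||H aH sMH [v vH vM] w] //; first by exists u.
apply: contraNT vM => wH; rewrite -(maxM H) //; apply/andP; split; last exact/invariantP.
by apply/properP; split; [apply: subsetT | exists w].
Qed.

Lemma max_invariant_exists (H : {group gT}) :
  {in H, forall u, a u \in H} -> (exists u, u \notin H) ->
  exists2 M, M \in max_invariant & H \subset M.
Proof.
move=> aH [u uH].
have [|M maxM sHM] := @maxgroup_exists _
   (fun M : {group gT} => (M \proper [set: gT]) && (a @: M \subset M)) H.
  by apply/andP; split; [apply/properP; split; [apply: subsetT|exists u] | apply/invariantP].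
by exists M; rewrite // inE.
Qed.

Hypotheses (aM : {morph a : u v / u * v}) (cT : forall u v : gT, u * v = v * u).
Variables (x : gT) (Lx : large_orbit a x).

Local Notation g := (pow_diff a).

Lemma normTabel (N : {group gT}) : [set: gT] \subset 'N(N).
Proof. by apply: sub_abelian_norm; [apply/centsP=> u _ v _; apply: cT | apply: subsetT]. Qed.

Lemma pow_diff_onto y : exists i j, y = g i j x.
Proof. exact: large_orbit_mulV. Qed.

Lemma invariant_large_orbit (H : {group gT}) :
  {in H, forall u, a u \in H} -> x \in H -> forall u, u \in H.
Proof.
move=> aH xH; apply: (large_orbit_sub Lx); apply/subsetP => _ /porbitP[i ->].
by rewrite invariantX_mem.
Qed.

(** The preimage of [H] under the map is an invariant subgroup that contains the generator [x],
    hence everything. *)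
Lemma pow_diff_sub (H : {group gT}) i j :
  {in H, forall u, a u \in H} -> g i j x \in H -> forall u, g i j u \in H.
Proof.
move=> aH gxH u.
suff: u \in pow_diff_pre_group aM cT i j H by rewrite inE.
apply: invariant_large_orbit; last by rewrite inE.
by move=> v; rewrite !inE pow_diff_comm // invariant_mem.
Qed.

Lemma large_orbit_notin M : M \in max_invariant -> {in porbit a x, forall y, y \notin M}.
Proof.
case/max_invariantP=> [[u uM] aN _] _ /porbitP[i ->]; rewrite invariantX_mem //.
by apply: contra uM => xM; apply: invariant_large_orbit.
Qed.

(** Write [y] as the value at [x] of a [pow_diff] map. The image of that map is invariant, and were
    it proper, some maximal invariant subgroup would contain it and [y]. So the map is a bijection
    commuting with [a], and [y] has a cycle as long as that of [x]. *)
Lemma mem_large_orbit y :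
  (forall M, M \in max_invariant -> y \notin M) -> y \in porbit a x.
Proof.
move=> yN; have [i [j yE]] := pow_diff_onto y.
pose H := pow_diff_im_group aM cT i j.
have HT u : u \in H.
  apply: contraT => uH; have [||M maxM sHM] := @max_invariant_exists H.
  - by move=> _ /imsetP[v _ ->]; rewrite -pow_diff_comm // imset_f.
  - by exists u.
  by case/negP: (yN M maxM); rewrite (subsetP sHM) // yE imset_f.
apply: large_orbit_mem => //; rewrite yE; apply: card_porbit_comm; last first.
  by move=> u; rewrite pow_diff_comm.
move=> u v; apply: (imset_injP _ _ _ (in_setT u) (in_setT v)).
by rewrite (_ : [set _ | _ in _] = [set: gT]) ?cardsT //; apply/setP=> w; rewrite HT inE.
Qed.

(** Schur's lemma on the simple quotient by [M]: the preimage of [M] under the map is an invariant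
    subgroup containing [M], so it is [M] or everything, and [x] excludes the latter. *)
Lemma pow_diff_Schur M i j u : M \in max_invariant ->
  g i j x \notin M -> g i j u \in M -> u \in M.
Proof.
case/max_invariantP=> _ aN maxM gxM guM; apply: contraNT gxM => uM.
suff: x \in pow_diff_pre_group aM cT i j M by rewrite inE.
apply: maxM; first by move=> v; rewrite !inE pow_diff_comm // invariant_mem.
- by apply/subsetP=> v vM; rewrite inE pow_diff_invariant.
- by exists u; rewrite // inE.
Qed.

(** Induction on [s]: given [y] for the other members and [z] in [L] outside [M], write [z] as the
    value at [x] of a [pow_diff] map. This map sends [y] into [L] by [pow_diff_sub], keeps it in the
    other members by invariance, and keeps it out of [M] by [pow_diff_Schur]. *)
Lemma max_invariant_independent (s : seq {group gT}) M :
  {subset s <= max_invariant} -> M \in max_invariant -> M \notin s ->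
  exists2 y, {in s, forall L : {group gT}, y \in L} & y \notin M.
Proof.
elim: s => [_ maxM _|L s IHs maxs maxM].
  by have [[u uM] _ _] := max_invariantP maxM; exists u.
rewrite inE negb_or => /andP[neML Ms].
have maxs' : {subset s <= max_invariant} by move=> K Ks; rewrite maxs // inE Ks orbT.
have [y ys yM] := IHs maxs' maxM Ms.
have maxL : L \in max_invariant by rewrite maxs ?mem_head.
have [_ aL fullL] := max_invariantP maxL.
have [z zL zM] : exists2 z, z \in L & z \notin M.
  apply/subsetPn; apply: contra neML => sLM; rewrite -val_eqE eq_sym eqEsubset sLM /=.
  have [[u uM] aN _] := max_invariantP maxM.
  apply/subsetPn => -[v vM vL]; case/negP: uM; apply: fullL => //.
  by exists v.
have [i [j zE]] := pow_diff_onto z.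
exists (g i j y); last by apply: contra yM; apply: pow_diff_Schur; rewrite -?zE.
move=> K; rewrite inE => /orP[/eqP-> | Ks]; first by apply: pow_diff_sub; rewrite -?zE.
apply: pow_diff_invariant (ys K Ks).
by have [] := max_invariantP (maxs' K Ks).
Qed.

Definition common (s : seq {group gT}) := \bigcap_(L in s) L.
Canonical common_group s := Eval hnf in [group of common s].

Lemma commonP s u : reflect {in s, forall L : {group gT}, u \in L} (u \in common s).
Proof. exact: bigcapP. Qed.

(** A Chinese remainder property: [common s] is not contained in the maximal [M], so the product of
    the two is the whole group. *)
Lemma max_invariant_mul (s : seq {group gT}) M u :
  {subset s <= max_invariant} -> M \in max_invariant -> M \notin s ->
  exists2 y, y \in common s & y^-1 * u \in M.
Proof.
move=> maxs maxM Ms; have [_ aN fullM] := max_invariantP maxM.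
have cMs : commute (common_group s) M.
  by apply: normC; rewrite (subset_trans _ (normTabel M)) ?subsetT.
have aC : {in common s, forall v, a v \in common s}.
  move=> v /commonP vs; apply/commonP => L Ls.
  by have [_ aL _] := max_invariantP (maxs L Ls); rewrite aL ?vs.
have gCM : group_set (common s * M) by apply/comm_group_setP.
have : u \in Group gCM.
  apply: fullM => [v /mulsgP[y z ys zM ->] /=||].
  - by rewrite aM mem_mulg ?aC ?aN.
  - exact: mulG_subr.
  have [y ys yM] := max_invariant_independent maxs maxM Ms.
  by exists y; rewrite // -[y]mulg1 mem_mulg //; apply/commonP.
by case/mulsgP=> y z ys zM ->; exists y; rewrite ?mulKg.
Qed.

Definition avoid (s : seq {group gT}) := [set u : gT | all (fun L : {group gT} => u \notin L) s].

Lemma avoidMl s y u : y \in common s -> (y * u \in avoid s) = (u \in avoid s).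
Proof.
move=> /commonP ys; rewrite !inE; apply: eq_in_all => L Ls.
by rewrite groupMl ?ys.
Qed.

(** Translation by an element of [common s] preserves [avoid s], and such translations reach every
    coset of [M]; so [avoid s] is spread evenly over these cosets. *)
Lemma card_avoid_coset s M u :
  {subset s <= max_invariant} -> M \in max_invariant -> M \notin s ->
  #|[set v in avoid s | coset M u == coset M v]| = #|avoid s :&: M|.
Proof.
move=> maxs maxM Ms; have [y ys yuM] := max_invariant_mul u maxs maxM Ms.
rewrite -(card_lcoset (avoid s :&: M) y); apply: eq_card => v.
rewrite mem_lcoset !in_set coset_eqT ?normTabel //; congr (_ && _).
  by have := @avoidMl s y (y^-1 * v) ys; rewrite mulKVg !in_set.
by rewrite -(groupMl _ yuM) mulgA mulgK.
Qed.

Definition quotient_order M := #|{: coset_of (M : {group gT})}|.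

Lemma card_avoid s M :
  {subset s <= max_invariant} -> M \in max_invariant -> M \notin s ->
  #|avoid s| = (quotient_order M * #|avoid s :&: M|)%N.
Proof.
move=> maxs maxM Ms; rewrite -sum1_card (partition_big (coset M) xpredT) //=.
rewrite -sum_nat_const; apply: eq_bigr => c _; rewrite sum1dep_card.
rewrite -[c]coset_reprK -(card_avoid_coset (repr c) maxs maxM Ms).
by apply: eq_card => v; rewrite !inE eq_sym.
Qed.

Lemma index_gt0 M : 0 < quotient_order M.
Proof. by apply/card_gt0P; exists 1. Qed.

(** Avoiding one more subgroup [M] discards one of [quotient_order M] equal shares. The quotients
    are multiplied out to stay in the natural numbers. *)
Lemma prod_avoid s : uniq s -> {subset s <= max_invariant} ->
  (#|avoid s| * \prod_(M <- s) quotient_order M = #|gT| * \prod_(M <- s) (quotient_order M).-1)%N.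
Proof.
elim: s => [_ _|M s IHs /=/andP[Ms us] maxs].
  by rewrite !big_nil !muln1; apply: eq_card => u; rewrite inE.
have maxM : M \in max_invariant by rewrite maxs ?mem_head.
have {}maxs : {subset s <= max_invariant} by move=> K Ks; rewrite maxs // inE Ks orbT.
have := card_avoid maxs maxM Ms; have := index_gt0 M; have := IHs us maxs.
have : (#|avoid s :&: M| + #|avoid (M :: s)| = #|avoid s|)%N.
  rewrite -(cardsID M (avoid s)); congr (_ + #|pred_of_set _|)%N.
  by apply/setP=> u; rewrite !inE.
rewrite !big_cons; move: (quotient_order M) => q.
move: (#|avoid s :&: M|) (#|avoid (M :: s)|) (#|avoid s|) => A B C.
move: (\prod_(_ <- _) _)%N (\prod_(_ <- _) _)%N #|gT| => P P' n <- eqP1 q_gt0 eqq.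
have -> : B = (A * q.-1)%N by nia.
rewrite [in RHS]mulnCA -eqP1 eqq; nia.
Qed.

Lemma max_invariant_prod :
  (#|porbit a x| * \prod_(M in max_invariant) quotient_order M =
   #|gT| * \prod_(M in max_invariant) (quotient_order M).-1)%N.
Proof.
rewrite -!big_enum /=.
have -> : porbit a x = avoid (enum max_invariant).
  apply/setP=> y; rewrite inE; apply/idP/allP => [yC M|yN].
    by rewrite mem_enum => maxM; apply: large_orbit_notin yC.
  by apply: mem_large_orbit => M maxM; apply: yN; rewrite mem_enum.
by apply: prod_avoid; [apply: enum_uniq | move=> M; rewrite mem_enum].
Qed.

End MaximalInvariant.

(** Powers of [a] take any nontrivial element to any other, so all of them have the same order,
    which Cauchy's theorem makes a prime. *)
Lemma transitive_prime_power (gT : finGroupType) (a : {perm gT}) x :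
  {morph a : u v / u * v} -> porbit a x = [set~ 1] ->
  exists p k, [/\ prime p, 0 < k & #|gT| = (p ^ k)%N].
Proof.
move=> aM Cx.
have gT_gt1 : 1 < #|[set: gT]|.
  rewrite cardG_gt1; apply/trivgPn; exists x; rewrite ?inE //.
  by have := porbit_id a x; rewrite Cx !inE.
pose p := pdiv #|[set: gT]|; have p_pr : prime p by apply: pdiv_prime.
have [z _ oz] := Cauchy p_pr (pdiv_dvd _).
have nz : z != 1 by rewrite -order_gt1 oz prime_gt1.
have Cz : porbit a z = [set~ 1].
  by rewrite -Cx; apply/eqP; rewrite eq_porbit_mem Cx !inE.
have ord_p (y : gT) : y ^+ p = 1.
  have [-> | ny] := eqVneq y 1; first by rewrite expg1n.
  have /porbitP[i ->] : y \in porbit a z by rewrite Cz !inE.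
  have aX n : (a ^+ i) z ^+ n = (a ^+ i) (z ^+ n).
    by elim: n => [|n IHn]; rewrite ?autX1 // !expgS autXM // IHn.
  by rewrite aX -oz expg_order autX1.
have pG : p.-group [set: gT].
  apply/pgroupP => q q_pr /Cauchy[//|y _ oy].
  have := ord_p y => /eqP; rewrite -order_dvdn oy dvdn_prime2 // => /eqP->.
have := card_pgroup pG; rewrite cardsT => eqG; exists p, (logn p #|gT|).
split=> //.
by rewrite logn_gt0 -cardsT pi_pdiv.
Qed.

(** * Orders of the simple quotients *)

Section AbelianOrbit.

Variables (gT : finGroupType) (a : {perm gT}).
Hypotheses (aM : {morph a : u v / u * v}) (cT : forall u v : gT, u * v = v * u).
Variables (x : gT) (Lx : large_orbit a x).

(** The set avoiding all the other maximal subgroups is nonempty and evenly spread over the cosets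
    of [M]; its points outside [M] belong to the cycle by [mem_large_orbit]. *)
Lemma coset_large_orbit M : M \in max_invariant a ->
  coset M @: porbit a x = [set~ 1].
Proof.
move=> maxM; have nM := normTabel cT M; apply/setP=> c; rewrite !inE.
apply/imsetP/idP => [[y yC ->]|].
  apply: contraNneq (large_orbit_notin Lx maxM yC) => /coset_idr; apply.
  exact: normT.
rewrite -[c]coset_reprK; move: (repr c) => u nu.
pose s := [seq L <- enum (max_invariant a) | L != M].
have maxs : {subset s <= max_invariant a} by move=> L; rewrite mem_filter mem_enum => /andP[].
have Ms : M \notin s by rewrite mem_filter eqxx.
have : 0 < #|[set v in avoid s | coset M u == coset M v]|.
  rewrite (card_avoid_coset aM cT Lx) //.
  suff : 0 < #|avoid s| by rewrite (card_avoid aM cT Lx maxs maxM Ms) muln_gt0 => /andP[].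
  apply/card_gt0P; exists x; rewrite inE; apply/allP=> L /maxs maxL.
  by apply: large_orbit_notin (porbit_id a x).
case/card_gt0P=> v; rewrite !inE => /andP[/allP vs /eqP eq_uv].
exists v => //; apply: mem_large_orbit => // L maxL.
have [-> | neLM] := eqVneq L M; last by apply: vs; rewrite mem_filter neLM mem_enum.
by apply: contra nu => vM; rewrite eq_uv coset_id.
Qed.

Lemma max_invariant_quotient M : M \in max_invariant a ->
  exists2 b : {perm coset_of M}, {morph b : u v / u * v} &
    (forall u, coset M (a u) = b (coset M u)) /\ porbit b (coset M x) = [set~ 1].
Proof.
move=> maxM; have [_ aN _] := max_invariantP maxM.
have [b bM bE] := quotient_perm aM (normTabel cT M) aN.
by exists b => //; split=> //; rewrite (porbit_imset _ bE) coset_large_orbit.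
Qed.

Lemma index_prime_power M : M \in max_invariant a ->
  exists p k, [/\ prime p, 0 < k & quotient_order M = (p ^ k)%N].
Proof.
by case/max_invariant_quotient=> b bM [_ /(transitive_prime_power bM)].
Qed.

Lemma card_porbit_index (M : {group gT}) (b : {perm coset_of M}) :
  porbit b (coset M x) = [set~ 1] -> #|porbit b (coset M x)| = (quotient_order M).-1.
Proof.
by move->; rewrite cardsC1.
Qed.

Lemma index_gt2 M : M \in max_invariant a -> 2 < quotient_order M.
Proof.
move=> maxM; have [b bM [bE Cb]] := max_invariant_quotient maxM.
have := large_orbit_quotient (normTabel cT M) bE Lx.
rewrite /large_orbit card_porbit_index // -/(quotient_order M); lia.
Qed.

(** The quotient by [M :&: M'] again has a large cycle. Its length divides the least common multiple
    of the cycle lengths on the two simple quotients. *)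
Lemma index_pair M M' : M \in max_invariant a -> M' \in max_invariant a ->
  M != M' ->
  (quotient_order M * quotient_order M' <
   2 * lcmn (quotient_order M).-1 (quotient_order M').-1)%N.
Proof.
move=> maxM maxM' neM.
have [_ aN _] := max_invariantP maxM; have [_ aN' _] := max_invariantP maxM'.
have aK : {in M :&: M', forall u, a u \in M :&: M'}.
  by move=> u /setIP[uM uM']; rewrite inE aN ?aN'.
have [b bM bE] := quotient_perm aM (normTabel cT [group of M :&: M']) aK.
have := large_orbit_quotient (normTabel cT [group of M :&: M']) bE Lx.
rewrite /large_orbit /=.
(* Since [M' * M] is everything, the indices multiply. *)
have -> : #|{: coset_of (M :&: M')}| = (quotient_order M * quotient_order M')%N.
  have mulT : M' * M = [set: gT].
    apply/setP=> u; rewrite inE.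
    have maxs : {subset [:: M'] <= max_invariant a} by move=> L; rewrite inE => /eqP->.
    have Ms : M \notin [:: M'] by rewrite inE.
    have [y] := max_invariant_mul aM cT Lx u maxs maxM Ms.
    move/commonP/(_ M' (mem_head _ _)) => yM' yuM.
    by apply/mulsgP; exists y (y^-1 * u); rewrite ?mulKVg.
  have := mul_cardG M' M; rewrite mulT setIC cardsT.
  have /= := card_coset_of (normTabel cT [group of M :&: M']).
  have := card_coset_of (normTabel cT M); rewrite -/(quotient_order M).
  have := card_coset_of (normTabel cT M'); rewrite -/(quotient_order M').
  have := cardG_gt0 M; have := cardG_gt0 M'; have /= := cardG_gt0 [group of M :&: M'].
  move: (quotient_order M) (quotient_order M') #|M| #|M'| #|M :&: M'| #|{: coset_of _}| #|gT|.
  move=> q q' m m' k c n k_gt0 m'_gt0 m_gt0 <- eqm eqk eqmm.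
  apply/eqP; rewrite -(eqn_pmul2r k_gt0) eqk -(eqn_pmul2r m_gt0) -mulnA [(m' * m)%N]mulnC.
  by rewrite [(m * m')%N]mulnC eqmm -eqm; apply/eqP; ring.
move=> lt_qq; apply: leq_trans lt_qq _; rewrite leq_pmul2l //.
have := index_gt2 maxM; have := index_gt2 maxM' => gt2' gt2.
apply: dvdn_leq; first by rewrite lcmn_gt0; lia.
rewrite -dvdn_card_porbit.
have bX i u : (b ^+ i) (coset (M :&: M') u) = coset (M :&: M') ((a ^+ i) u).
  by elim: i => [|i IHi]; rewrite ?perm1 // !expgSr !permM bE IHi.
rewrite bX eq_sym (coset_eqT (normTabel cT [group of M :&: M'])) inE.
rewrite -!(coset_eqT (normTabel cT _)).
have fixC L : L \in max_invariant a ->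
   (quotient_order L).-1 %| lcmn (quotient_order M).-1 (quotient_order M').-1 ->
   coset L x == coset L ((a ^+ lcmn (quotient_order M).-1 (quotient_order M').-1) x).
  move=> maxL; have [d dM [dE Cd]] := max_invariant_quotient maxL.
  have dX i u : (d ^+ i) (coset L u) = coset L ((a ^+ i) u).
    by elim: i => [|i IHi]; rewrite ?perm1 // !expgSr !permM dE IHi.
  by rewrite -(card_porbit_index Cd) // -dX eq_sym dvdn_card_porbit => ->.
by rewrite !fixC ?dvdn_lcml ?dvdn_lcmr.
Qed.

(** A common divisor of at least 2 would push twice the least common multiple down to the product of
    the predecessors, against [index_pair]. *)
Lemma index_coprime M M' : M \in max_invariant a -> M' \in max_invariant a ->
  M != M' -> coprime (quotient_order M).-1 (quotient_order M').-1.
Proof.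
move=> maxM maxM' /(index_pair maxM maxM').
have := index_gt2 maxM; have := index_gt2 maxM'; rewrite /coprime.
have := muln_lcm_gcd (quotient_order M).-1 (quotient_order M').-1.
by move: (gcdn _ _) => [|[|d]]; move=> *; nia.
Qed.

End AbelianOrbit.

(** * Inverted elements and the centerless case *)

Section Commutativity.

Variables (gT : finGroupType) (a : {perm gT}).
Hypothesis (aM : {morph a : u v / u * v}).
Variables (x : gT) (Lx : large_orbit a x).
Variable j : nat.
Hypothesis bV : forall y, y \in porbit a x -> (a ^+ j) y = y^-1.

Local Notation beta := (a ^+ j).
Local Notation G := [set: gT].

(** If [y] and [y * n] are both on the cycle, then [beta] inverts both, and comparing gives the
    formula at [n]. This covers more than half of [N] by [large_orbit_fiber], and the solutions form
    a subgroup because [N] is abelian. *)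
Lemma beta_conj (N : {group gT}) : G \subset 'N(N) ->
  {in N, forall u, a u \in N} -> abelian N ->
  forall y n, y \in porbit a x -> n \in N -> beta n = y * n^-1 * y^-1.
Proof.
move=> nN aN abN y n yC nN'.
have gK : group_set [set m in N | beta m == y * m^-1 * y^-1].
  apply/group_setP; split=> [|u v]; rewrite !inE.
    by rewrite group1 autX1 // invg1 mulg1 mulgV eqxx.
  case/andP=> uN /eqP bu /andP[vN /eqP bv]; rewrite groupM //= autXM // bu bv invMg.
  rewrite !mulgA mulgKV; apply/eqP; congr (_ * _).
  by rewrite -!mulgA; congr (_ * _); apply: (centsP abN); rewrite groupV.
have sKN : Group gK \subset N by apply/subsetP=> u; rewrite inE => /andP[].
have /subgroup_half eqK : #|N| < 2 * #|Group gK|.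
  have := large_orbit_fiber aM nN aN (large_orbit_porbit Lx yC).
  move=> /leq_trans -> //; rewrite leq_pmul2l //; apply/subset_leq_card/subsetP=> m.
  rewrite !inE => /andP[-> ymC] /=.
  have : y * m \in porbit a x by move: yC ymC; rewrite -eq_porbit_mem => /eqP->.
  move/bV; rewrite autXM // bV // invMg => /(canRL (mulKVg _)) ->.
  by rewrite mulgA.
by move: nN'; rewrite -(eqK sKN) inE => /andP[_ /eqP].
Qed.

(** By [beta_conj], all points of the cycle act on [N] by the same conjugation, so quotients of two
    of them centralize [N]; every element of the group is such a quotient. *)
Lemma abelian_normal_central (N : {group gT}) : G \subset 'N(N) ->
  {in N, forall u, a u \in N} -> abelian N -> N \subset 'C(G).
Proof.
move=> nN aN abN; apply/centsP => n nN' g _.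
have [k [l ->]] := large_orbit_mulV g Lx.
set u := _ x; set v := (a ^+ l) x.
have uC : u \in porbit a x by apply: mem_porbit.
have vC : v \in porbit a x by apply: mem_porbit.
have n'N : (n ^ v)^-1 \in N by rewrite groupV memJ_norm // normT.
have := beta_conj nN aN abN vC n'N; rewrite (beta_conj nN aN abN uC n'N) invgK.
rewrite conjgE !mulgA mulgV mul1g mulgK => uE.
by rewrite /commute -{1}uE !mulgA mulgKV mulgK.
Qed.

Lemma beta_central (N : {group gT}) : G \subset 'N(N) ->
  {in N, forall u, a u \in N} -> N \subset 'C(G) ->
  forall n, n \in N -> beta n = n^-1.
Proof.
move=> nN aN cN n nN'.
have abN : abelian N by apply: subset_trans cN (centS (subsetT _)).
rewrite (beta_conj nN aN abN (porbit_id a x) nN').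
by rewrite -(centsP cN n^-1 _ x) ?groupV ?inE // mulgK.
Qed.

Lemma large_orbit_central :
  (forall y, y \in porbit a x -> y \in 'C(G)) -> forall u v : gT, u * v = v * u.
Proof.
move=> Cc u v.
have /centP cu : u \in 'C(G) by apply: (large_orbit_sub Lx); apply/subsetP.
exact: cu.
Qed.

Lemma large_orbit_neq1 u v : u * v != v * u :> gT -> x != 1.
Proof.
apply: contraNneq => x1; apply/eqP; apply: large_orbit_central => y.
by rewrite x1 => /porbitP[i ->]; rewrite autX1 // group1.
Qed.

Section TrivialCenter.

Hypothesis cG : forall z : gT, z != 1 -> 3 * #|'C_G[z]| <= #|gT|.
Hypothesis nx : x != 1.

Definition inverted := [set y | beta y == y^-1].

Lemma invertedP y : reflect (beta y = y^-1) (y \in inverted).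
Proof. by rewrite inE; apply: eqP. Qed.

(** For inverted [y] and [z], [beta] sends [y * z] to the inverse of [z * y]. *)
Lemma inverted_commute y z : y \in inverted -> z \in inverted ->
  (y * z \in inverted) = (y * z == z * y).
Proof.
move=> /invertedP by_ /invertedP bz; rewrite inE autXM // by_ bz -invMg.
by rewrite (inj_eq (@invg_inj gT)) eq_sym.
Qed.

Lemma card_inverted : #|gT| < 2 * #|inverted|.
Proof.
apply: leq_trans Lx _; rewrite leq_pmul2l //; apply/subset_leq_card/subsetP=> y.
by move/bV/eqP; rewrite inE.
Qed.

(* For each [g], the [m] in [A] with [m * g] inverted lie in one coset of
   ['C_A[g]]; summing over [g] bounds [#|A|]. *)
Lemma card_abelian_inverted (A : {group gT}) :
  abelian A -> A \subset inverted -> #|A| <= 3.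
Proof.
move=> abA sAS.
have le1 : #|A| * #|inverted| <= \sum_(g : gT) #|'C_A[g]|.
  have -> : (#|A| * #|inverted| = \sum_(g : gT) #|[set m in A | (m * g)%g \in inverted]|)%N.
    under eq_bigr do rewrite -sum1dep_card.
    rewrite (exchange_big_dep (mem A)) /=; last by move=> ? ? _ /andP[].
    rewrite -sum_nat_const; apply: eq_bigr => m mA; rewrite sum1dep_card.
    rewrite -(card_lcoset inverted m^-1); apply: eq_card => g.
    by rewrite mem_lcoset invgK [RHS]in_set mA.
  apply: leq_sum => g _; have [-> | [m0]] := set_0Vmem [set m in A | m * g \in inverted].
    by rewrite cards0.
  rewrite in_set => /andP[m0A m0S]; rewrite -(card_rcoset 'C_A[g] m0).
  apply/subset_leq_card/subsetP=> m; rewrite in_set mem_rcoset => /andP[mA mS].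
  have kA : m * m0^-1 \in A by rewrite groupM ?groupV.
  rewrite inE kA /=.
  have : (m * m0^-1) * (m0 * g) \in inverted by rewrite mulgA mulgKV.
  rewrite inverted_commute // ?(subsetP sAS) //; move: (m * m0^-1) kA => k kA /eqP ck.
  suff ckg : g * k = k * g by apply/cent1P; rewrite /commute ckg.
  apply: (mulgI m0); rewrite [LHS]mulgA -ck !mulgA; congr (_ * _).
  exact: (centsP abA).
have le2 : \sum_(g : gT) #|'C_A[g]| = (\sum_(m in A) #|'C_G[m]|)%N.
  under [LHS]eq_bigr do rewrite -sum1_card.
  rewrite (exchange_big_dep (mem A)) /=; last by move=> ? ? _ /setIP[].
  apply: eq_bigr => m mA; rewrite sum1dep_card; apply: eq_card => g.
  by rewrite inE !in_setI mA in_setT cent1C.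
have le3 : 3 * \sum_(m in A) #|'C_G[m]| <= (3 * #|gT| + (#|A|.-1) * #|gT|)%N.
  rewrite (big_setD1 1) ?group1 //= mulnDr leq_add //.
    by rewrite leq_pmul2l // -cardsT subset_leq_card ?subsetT.
  rewrite big_distrr /= (cardsD1 1 A) group1 /= -sum_nat_const.
  by apply: leq_sum => m; rewrite !inE => /andP[nm _]; apply: cG.
(* Together these give 3 |A| |S| <= (|A| + 2) |G| for the inverted set S; as 2 |S| > |G|, it follows
   that |A| < 4. *)
have := card_inverted; have := cardG_gt0 A; rewrite le2 in le1.
move: le1 le3; move: (\sum_(_ in _) _)%N #|A| #|inverted| #|gT| => s A' S n; nia.
Qed.

(** The abelian group generated by [k] and [y] consists of inverted elements, so its order is at
    most 3. The order of its nontrivial subgroup [<[k]>] divides this, so the two coincide. *)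
Lemma inverted_cent1 k y : k \in inverted -> k != 1 -> y \in inverted ->
  k * y = y * k -> y \in <[k]>.
Proof.
move=> kS nk yS cky.
have inS u v : u \in inverted -> v \in inverted -> u * v = v * u -> u * v \in inverted.
  by move=> uS vS cuv; rewrite inverted_commute ?cuv.
have XS u n : u \in inverted -> u ^+ n \in inverted.
  move=> uS; elim: n => [|n IHn]; first by rewrite inE autX1 // invg1.
  by rewrite expgS inS // -expgS -expgSr.
have cyk : <[y]> \subset 'C(<[k]>) by rewrite cent_cycle cycle_subG; apply/cent1P.
have ckX u v : u \in <[k]> -> v \in <[y]> -> u * v = v * u.
  by move=> uk vy; rewrite (centsP cyk v vy).
have gB : group_set (<[k]> * <[y]>).
  by apply/comm_group_setP; apply: normC; apply: cents_norm; rewrite centsC.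
have abB : abelian (Group gB).
  by rewrite /= abelianM !cycle_abelian.
have sBS : Group gB \subset inverted.
  apply/subsetP => _ /mulsgP[_ _ /cycleP[m ->] /cycleP[n ->] ->].
  by rewrite inS ?XS // ckX ?mem_cycle.
have := card_abelian_inverted abB sBS; rewrite /= => le3.
have skB : <[k]> \subset Group gB by apply: mulG_subl.
suff /eqP eqB : <[k]> == Group gB :> {set gT} by rewrite eqB (subsetP (mulG_subr _ _)) ?cycle_id.
rewrite eqEcard skB /=.
have le_dvd m n : 1 < m -> m %| n -> 0 < n -> n <= 3 -> n <= m.
  by case: m => [|[|[|m]]] //; case: n => [|[|[|[|n]]]].
apply: le_dvd le3; [|exact: cardSg skB|exact: cardG_gt0 (Group gB)].
by rewrite cardG_gt1 cycle_eq1.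
Qed.

(** Let [A] be generated by [x], of order 2 or 3. The translates by [A] of the inverted elements
    outside [A] do not overlap: an overlap would give a nontrivial element of [A] commuting with an
    inverted element outside [A]. Counting these translates outside [A] bounds the group. *)
Lemma card_centerless_le3 : #|gT| <= 3.
Proof.
have xS : x \in inverted by apply/invertedP/bV/porbit_id.
pose A := <[x]>.
have sAS : A \subset inverted.
  apply/subsetP=> _ /cycleP[n ->]; elim: n => [|n IHn]; first by rewrite inE autX1 // invg1.
  by rewrite expgS inverted_commute // -expgS -expgSr.
have leA := card_abelian_inverted (cycle_abelian x) sAS.
have gtA : 1 < #|A| by rewrite cardG_gt1 cycle_eq1.
have le1 : #|A| * #|inverted :\: A| <= #|G :\: A|.
  rewrite -cardsX -(card_in_imset (f := fun p : gT * gT => p.1 * p.2)).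
    apply/subset_leq_card/subsetP=> _ /imsetP[[m s] /setXP[mA /setDP[_ sA]] ->].
    by rewrite !inE groupMl ?sA.
  move=> [m s] [m' s'] /setXP[mA /setDP[sS sA]] /setXP[m'A /setDP[s'S s'A]] /= eq_ms.
  have sE : s = (m^-1 * m') * s' by rewrite -mulgA -eq_ms mulKg.
  have kA : m^-1 * m' \in A by rewrite groupM ?groupV.
  have [k1 | nk] := eqVneq (m^-1 * m') 1.
    by rewrite sE k1 mul1g -(mulg1 m) -k1 mulKVg.
  have := sS; rewrite sE inverted_commute ?(subsetP sAS _ kA) // => /eqP ck.
  case/negP: s'A; apply: (subsetP (_ : <[m^-1 * m']> \subset A)).
    by rewrite cycle_subG.
  exact: inverted_cent1 (subsetP sAS _ kA) nk s'S ck.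
(* The identity is inverted but not on the cycle. This one extra element is what rules out [A] of
   order 2 in the final count. *)
have S1 : #|porbit a x| < #|inverted|.
  apply: proper_card; apply/properP; split.
    by apply/subsetP=> y /bV/eqP; rewrite inE.
  exists 1; first by rewrite inE autX1 // invg1.
  apply: contra nx => /porbitP[i] /esym; rewrite -[X in _ = X](autX1 aM i).
  by move/perm_inj->.
have := Lx; rewrite /large_orbit; move: S1 le1.
have := cardsID A inverted; rewrite (setIidPr sAS).
have := cardsID A G; rewrite setTI cardsT.
move: leA gtA; move: #|A| #|inverted| #|inverted :\: A| #|G :\: A| #|gT| #|porbit a x|.
by move=> [|[|[|[|?]]]] // S SA GA n L _ _; lia.
Qed.

End TrivialCenter.

End Commutativity.

(** * Lifting commutativity from the central quotient *)

Section CenterQuotient.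

Variables (gT : finGroupType) (a : {perm gT}).
Hypothesis (aM : {morph a : u v / u * v}).
Variables (x : gT) (Lx : large_orbit a x).

Local Notation G := [set: gT].
Local Notation Z := 'Z(G).

Lemma centerT z : (z \in Z) = (z \in 'C(G)).
Proof. by rewrite inE in_setT. Qed.

Lemma center_normT : G \subset 'N(Z).
Proof. exact: normal_norm (center_normal _). Qed.

Lemma center_invariant : {in Z, forall u, a u \in Z}.
Proof.
move=> u; rewrite !centerT => /centP cu; apply/centP => v _.
have [w ->] : exists w, v = a w by exists (a^-1 v); rewrite permKV.
by rewrite /commute -!aM cu ?inE.
Qed.

Hypothesis cV : forall c d : coset_of Z, c * d = d * c.
Variable b : {perm coset_of Z}.
Hypotheses (bM : {morph b : u v / u * v}) (abE : forall u, coset Z (a u) = b (coset Z u)).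

Local Notation xb := (coset Z x).
Let Lxb : large_orbit b xb := large_orbit_quotient center_normT abE Lx.

(** A lift of a point on the cycle of [b] is a point on the cycle of [a] times a central element,
    and the inverting power of [a] inverts both factors. When it inverts [u], [v] and [u * v], the
    first two commute. *)
Lemma lift_orbit_commute u v :
  coset Z u \in porbit b xb -> coset Z v \in porbit b xb ->
  coset Z (u * v) \in porbit b xb -> u * v = v * u.
Proof.
have [j bV] := large_orbit_inverter aM Lx.
have bZ z : z \in Z -> (a ^+ j) z = z^-1.
  apply: (beta_central aM Lx bV center_normT center_invariant).
  by apply/subsetP=> w; rewrite centerT.
have bE w : coset Z w \in porbit b xb -> (a ^+ j) w = w^-1.
  rewrite (porbit_imset _ abE) => /imsetP[c cC /eqP].
  rewrite eq_sym (coset_eqT center_normT) => zZ; rewrite -[w](mulKVg c).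
  move: (c^-1 * w) zZ => z zZ; rewrite autXM // bV // bZ // -invMg; congr _^-1.
  by move: zZ; rewrite centerT => /centP-> //; rewrite inE.
move=> /bE bu /bE bv /bE; rewrite autXM // bu bv -invMg => /invg_inj ->.
by [].
Qed.

Definition cent_quotient y := 'C[y] / Z.
Canonical cent_quotient_group y := Eval hnf in [group of cent_quotient y].

Lemma cent_quotientP y w : (coset Z w \in cent_quotient y) = (y * w == w * y).
Proof.
apply/idP/eqP => [|cyw].
  case/morphimP=> v _ /cent1P cv /eqP.
  rewrite (coset_eqT center_normT) => zZ.
  have zZ' : (w^-1 * v)^-1 \in 'C(G) by rewrite groupV -centerT.
  rewrite -[w](mulKVg v) (_ : v^-1 * w = (w^-1 * v)^-1); last by rewrite invMg invgK.
  move/centP: zZ' => cz; rewrite -[RHS]mulgA cz ?inE // !mulgA; congr (_ * _).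
  by rewrite cv.
by apply: mem_quotient; apply/cent1P.
Qed.

Lemma cosetTP (c : coset_of Z) : exists u, c = coset Z u.
Proof. by exists (repr c); rewrite coset_reprK. Qed.

Lemma cent_quotient_mem y c : y \in porbit a x ->
  c \in porbit b xb -> c * coset Z y \in porbit b xb -> c \in cent_quotient y.
Proof.
move=> yC; have [u ->] := cosetTP c => uC; rewrite -(cosetTM center_normT) => uyC.
by rewrite cent_quotientP eq_sym; apply/eqP/lift_orbit_commute => //;
  rewrite (porbit_imset _ abE) imset_f.
Qed.

Lemma cent_quotient_full y :
  (forall c, c \in cent_quotient y) -> y \in 'C(G).
Proof. by move=> cy; apply/centP=> u _; apply/eqP; rewrite -cent_quotientP. Qed.

(** Otherwise an element of [common s] outside [M] would lift to one commuting with the whole cycle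
    of [a], which generates the group; the lift would be central and its coset trivial. *)
Lemma common_cent_quotient (s : seq {group coset_of Z}) M :
  {subset s <= max_invariant b} -> M \in max_invariant b -> M \notin s ->
  exists2 y, y \in porbit a x & ~~ (common s \subset cent_quotient y).
Proof.
move=> maxs maxM Ms.
have [m ms mM] := max_invariant_independent bM cV Lxb maxs maxM Ms.
have [/existsP[y /andP[yC sN]] | ] :=
  boolP [exists y, (y \in porbit a x) && ~~ (common s \subset cent_quotient y)].
  by exists y.
rewrite negb_exists => /forallP sub; case/negP: mM.
have [w mE] := cosetTP m.
suff /coset_id wZ : w \in Z by rewrite mE wZ group1.
rewrite centerT; apply/centP => u _.
have : u \in 'C[w]%G.
  apply: (large_orbit_sub Lx); apply/subsetP => y yC; apply/cent1P.
  have := sub y; rewrite yC negbK => /subsetP sHy.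
  have : m \in cent_quotient y by apply: sHy; apply/commonP.
  by rewrite mE cent_quotientP => /eqP; rewrite /commute => ->.
by move/cent1P.
Qed.

(** The cycle meets its right translate by the inverse of [c]. *)
Lemma orbit_step c : exists2 v, v \in porbit b xb & v * c \in porbit b xb.
Proof.
have [|v vC /rcosetP[w wC vE]] := @ltn_card_meet _ (porbit b xb) (porbit b xb :* c^-1).
  by rewrite card_rcoset addnn -mul2n.
by exists v => //; rewrite vE mulgKV.
Qed.

(* If [v] and [v * y] are in the cycle, translating them by the intersection [J]
   of the other maximal subgroups leaves the cycle only through [M], so all but
   two cosets of [J :&: M] in [J] commute with [y]. *)
Lemma index_le4 M : M \in max_invariant b -> quotient_order M <= 4.
Proof.
move=> maxM; pose s := [seq L <- enum (max_invariant b) | L != M].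
have maxs : {subset s <= max_invariant b}.
  by move=> L; rewrite mem_filter mem_enum => /andP[].
have Ms : M \notin s by rewrite mem_filter eqxx.
have [y yC nsH] := common_cent_quotient maxs maxM Ms.
set J := common_group s; set H := cent_quotient_group y.
have [v vC vyC] := orbit_step (coset Z y).
have orbE c : (forall L, L \in s -> c \notin (L : {group _})) -> c \notin M -> c \in porbit b xb.
  move=> cs cM; apply: (mem_large_orbit bM cV Lxb) => L maxL.
  have [-> // | neLM] := eqVneq L M.
  by apply: cs; rewrite mem_filter neLM mem_enum.
have vmC c m : c \in porbit b xb -> m \in J -> c * m \notin M -> c * m \in porbit b xb.
  move=> cC /commonP mJ; apply: orbE => L Ls; rewrite groupMr ?mJ //.
  exact: (large_orbit_notin Lxb) (maxs L Ls) _ cC.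
pose bad c := [set m in J | c * m \in M].
have badC c : #|bad c| <= #|J :&: M|.
  have [-> | [m0]] := set_0Vmem (bad c); first by rewrite cards0.
  rewrite inE => /andP[m0J m0M]; rewrite -(card_lcoset (J :&: M) m0).
  apply/subset_leq_card/subsetP=> m; rewrite inE => /andP[mJ mM].
  rewrite mem_lcoset inE groupM ?groupV //=.
  by rewrite -(groupMl (m0^-1 * m) m0M) -mulgA mulKVg.
have cov : J \subset (J :&: H) :|: (bad v :|: bad (v * coset Z y)).
  apply/subsetP=> m mJ; rewrite !in_setU in_setI ![m \in bad _]inE mJ /=.
  have [//|vmM] := boolP (v * m \in M); first by rewrite orbT.
  have [//|vymM] := boolP (v * coset Z y * m \in M); first by rewrite !orbT.
  rewrite !orbF -(groupMl m (cent_quotient_mem yC vC vyC)).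
  apply: cent_quotient_mem yC (vmC _ _ vC mJ vmM) _.
  by rewrite -mulgA [m * _]cV mulgA vmC.
have leJ : #|J| <= #|J :&: H| + (#|J :&: M| + #|J :&: M|).
  apply: leq_trans (subset_leq_card cov) _; apply: leq_trans (leq_card_setU _ _) _.
  rewrite leq_add2l; apply: leq_trans (leq_card_setU _ _) _.
  exact: leq_add (badC _) (badC _).
have halfJ : 2 * #|J :&: H| <= #|J|.
  rewrite leqNgt; apply: contra nsH => lt.
  by have := @subgroup_half _ [group of J :&: H] J (subsetIl _ _) lt => /setIidPl.
have JM : J * M = [set: coset_of Z].
  apply/setP=> u; rewrite inE; have [t tJ tM] := max_invariant_mul bM cV Lxb u maxs maxM Ms.
  by apply/mulsgP; exists t (t^-1 * u); rewrite ?mulKVg.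
(* The product formula gives |J| = q k with k the order of [J :&: M], while the two bounds above
   give |J| <= |J| / 2 + 2 k. *)
have := mul_cardG J M; rewrite JM cardsT.
have := card_coset_of (normTabel cV M); rewrite -/(quotient_order M).
have := cardG_gt0 M; have := cardG_gt0 J; have := cardG_gt0 [group of J :&: M] => /=.
move: leJ halfJ; rewrite /J /H /=.
move: (quotient_order M) #|_ :&: cent_quotient _| #|_ :&: M| #|M| #|common _| #|{: coset_of Z}|.
move=> q h k m n V le1 le2 k_gt0 n_gt0 m_gt0 <- eq1.
have nE : n = (q * k)%N by apply/eqP; rewrite -(eqn_pmul2r m_gt0) eq1 mulnAC.
rewrite -(leq_pmul2r k_gt0) -nE; lia.
Qed.

(** Two orders among 3 and 4 violate [index_pair], so there is at most one maximal invariant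
    subgroup, and the cycle of [b] is its complement. This suffices to show each point of the cycle
    of [a] central. *)
Lemma center_quotient_abelian u v : u * v = v * u :> gT.
Proof.
have [/forallP /= xZ | ] := boolP [forall y, (y \in porbit a x) ==> (y \in 'C(G))].
  by apply: (large_orbit_central Lx) => y yC; have := xZ y; rewrite yC.
rewrite negb_forall => /existsP[y]; rewrite negb_imply => /andP[yC /negP[]].
have uniqM M M' : M \in max_invariant b -> M' \in max_invariant b -> M = M'.
  move=> maxM maxM'; apply/eqP; apply: contraT => neM.
  have := index_pair bM cV Lxb maxM maxM' neM.
  have := index_le4 maxM; have := index_le4 maxM'.
  have := index_gt2 bM cV Lxb maxM; have := index_gt2 bM cV Lxb maxM'.
  by case: (quotient_order M) => [|[|[|[|[|?]]]]] //; case: (quotient_order M') => [|[|[|[|[|?]]]]].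
apply: cent_quotient_full => c; set H := cent_quotient_group y.
have [v0 v0C v0yC] := orbit_step (coset Z y).
have v0H : v0 \in H by apply: cent_quotient_mem.
have yH : coset Z y \in H by rewrite cent_quotientP.
have [/existsP[M maxM] | ] := boolP [exists M, M \in max_invariant b]; last first.
  rewrite negb_exists => /forallP no; have orbT c' : c' \in porbit b xb.
    by apply: (mem_large_orbit bM cV Lxb) => M; rewrite (negbTE (no M)).
  exact: cent_quotient_mem.
have orbE c' : c' \notin M -> c' \in porbit b xb.
  move=> cM; apply: (mem_large_orbit bM cV Lxb) => M' maxM'.
  by rewrite (uniqM _ _ maxM' maxM).
have notM c' : c' \in porbit b xb -> c' \notin M.
  by apply: (large_orbit_notin Lxb).
(* Multiplying [v0] and [v0 * coset Z y] by [m] keeps both outside [M], so [v0 * m] lies in [H]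
   together with [v0]. *)
have MH m : m \in M -> m \in H.
  move=> mM; rewrite -(groupMl m v0H); apply: cent_quotient_mem => //.
    by rewrite orbE // groupMr // notM.
  by rewrite orbE // -mulgA [m * _]cV mulgA groupMr // notM.
have [cM | ncM] := boolP (c \in M); first exact: MH.
have [cyM | ncyM] := boolP (c * coset Z y \in M).
  by rewrite -(groupMr _ yH) MH.
by apply: cent_quotient_mem; rewrite ?orbE.
Qed.

End CenterQuotient.

(** * Commutativity by induction on the order *)

Theorem large_orbit_abelian (gT : finGroupType) (a : {perm gT}) x :
  {morph a : u v / u * v} -> large_orbit a x -> forall u v : gT, u * v = v * u.
Proof.
have [n] := ubnP #|gT|; elim: n gT a x => // n IHn gT a x; rewrite ltnS => le_n aM Lx u v.
have IHq (N : {group gT}) : [set: gT] \subset 'N(N) ->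
    {in N, forall u, a u \in N} -> N :!=: 1 -> forall c d : coset_of N, c * d = d * c.
  move=> nN aN ntN; have [b bM bE] := quotient_perm aM nN aN.
  apply: IHn bM (large_orbit_quotient nN bE Lx).
  apply: leq_trans le_n; rewrite -(card_coset_of nN) ltn_Pmulr ?cardG_gt1 //.
  by apply/card_gt0P; exists 1.
pose G := [set: gT]%G.
have [Z1 | ntZ] := eqVneq 'Z(G) 1; last first.
  have cV := IHq _ (center_normT _) (center_invariant aM) ntZ.
  have [b bM bE] := quotient_perm aM (center_normT _) (center_invariant aM).
  exact: (center_quotient_abelian aM Lx cV bM bE).
have [j bV] := large_orbit_inverter aM Lx.
have der1_comm (N : {group gT}) : [set: gT] \subset 'N(N) ->
    (forall c d : coset_of N, c * d = d * c) -> G^`(1) \subset N.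
  by move=> nN cN; apply: der1_min => //; apply/centsP=> c _ d _; apply: cN.
have normD : [set: gT] \subset 'N(G^`(1)) by apply: normal_norm; apply: der_normal.
have aD : {in G^`(1), forall u, a u \in G^`(1)}.
  pose am : {morphism G >-> gT} := Morphism (D := G) (in2W aM).
  have := morphim_der am 1 (subxx G).
  have -> : am @* G = G.
    have injam : 'injm am by apply/injmP=> ? ? _ _; apply: perm_inj.
    by apply/eqP; rewrite eqEcard subsetT (card_injm injam) ?subxx ?leqnn.
  by move=> eqD w wD; rewrite -eqD; apply: mem_morphim; rewrite ?inE.
have central1 : 'C(G) = 1 by rewrite -Z1 /center setTI.
(* If the centralizer of the derived subgroup is nontrivial, the quotient by it is abelian by
   induction, so the derived subgroup centralizes itself. Being abelian it is central, hence
   trivial. *)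
have [C1 | ntC] := eqVneq 'C(G^`(1)) 1; last first.
  have normC : [set: gT] \subset 'N('C(G^`(1))) by rewrite norms_cent.
  have aC : {in 'C(G^`(1)), forall u, a u \in 'C(G^`(1))}.
    move=> w /centP cw; apply/centP=> d.
    have [e ->] : exists e, d = a e by exists (a^-1 d); rewrite permKV.
    by rewrite (invariant_mem _ aD) => eD; rewrite /commute -!aM cw.
  have sDC := der1_comm _ normC (IHq _ normC aC ntC).
  have := abelian_normal_central aM Lx bV normD aD sDC.
  rewrite central1 => sD1.
  have : abelian G by rewrite /abelian; apply/commG1P/trivgP; apply: sD1.
  by move/centsP; apply; rewrite inE.
(* A centralizer of index at most 2 is normal with abelian quotient, so it contains the derived
   subgroup; then [z] centralizes that subgroup and must be trivial. *)
have cG z : z != 1 -> 3 * #|'C_G[z]| <= #|gT|.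
  move=> nz; rewrite -cardsT -(Lagrange (subsetIl G 'C[z])) /= mulnC leq_pmul2l ?cardG_gt0 //.
  rewrite ltnNge; apply/negP => le2.
  have nC : G \subset 'N('C_G[z]).
    have := indexg_gt0 G 'C_G[z]; case eqi : #|G : _| le2 => [|[|[|k]]] // _ _.
      by rewrite (index1g (subsetIl _ _) eqi) normG.
    by rewrite normal_norm // index2_normal ?subsetIl.
  have cN (c d : coset_of 'C_G[z]) : c * d = d * c.
    have cyc : abelian (G / 'C_G[z]).
      have leq2 : #|G / 'C_G[z]| <= 2 by rewrite card_quotient.
      have := cardG_gt0 (G / 'C_G[z]).
      case eqc : #|_| leq2 => [|[|[|k]]] // _ _; last by rewrite cyclic_abelian ?prime_cyclic ?eqc.
      by have /card1_trivg -> := eqc; apply: abelian1.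
    by apply: (centsP cyc); rewrite (_ : G / _ = setT) ?inE // -(quotientT 'C_G[z]).
  have := der1_comm [group of 'C_G[z]] nC cN => /= sDC.
  have : z \in 'C(G^`(1)) by apply/centP => d /(subsetP sDC) /setIP[_ /cent1P].
  by rewrite C1 => /set1P z1; rewrite z1 eqxx in nz.
have [//|ne] := eqVneq (u * v) (v * u).
have nx := large_orbit_neq1 aM Lx ne.
have le3 := card_centerless_le3 aM Lx bV cG nx.
have le3' : #|G| <= 3 by rewrite cardsT.
have cyc : abelian G.
  have := cardG_gt0 G; case eqc : #|_| le3' => [|[|[|[|k]]]] // _ _.
  - by have /card1_trivg -> := eqc; apply: abelian1.
  - by rewrite cyclic_abelian ?prime_cyclic ?eqc.
  by rewrite cyclic_abelian ?prime_cyclic ?eqc.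
by apply: (centsP cyc); rewrite inE.
Qed.

(** * Orders attached to a large cycle, and their realization *)

Lemma card_porbit_le_max (T : finType) (a : {perm T}) x : #|porbit a x| <= max_cycle_length a.
Proof.
have mem_x : porbit a x \in porbits a by apply: imset_f.
exact: (@leq_bigmax_cond _ (mem (porbits a)) (fun C : {set T} => #|C|) _ mem_x).
Qed.

Lemma max_cycle_length_le (T : finType) (a : {perm T}) n :
  (forall x, #|porbit a x| <= n) -> max_cycle_length a <= n.
Proof. by move=> le_n; apply/bigmax_leqP => _ /imsetP[x _ ->]. Qed.

Lemma max_cycle_length_attained (T : finType) (a : {perm T}) (x0 : T) :
  exists x, max_cycle_length a = #|porbit a x|.
Proof.
have [|C /imsetP[x _ ->] E] := @eq_bigmax_cond _ (mem (porbits a)) (fun C : {set T} => #|C|).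
  by apply/card_gt0P; exists (porbit a x0); apply: imset_f.
by exists x; rewrite -E.
Qed.

Lemma max_cycle_length_gt0 (T : finType) (a : {perm T}) (x0 : T) : 0 < max_cycle_length a.
Proof. by apply: leq_trans (card_porbit_le_max a x0); rewrite lt0n card_porbit_neq0. Qed.

Lemma max_cycle_length_le_card (T : finType) (a : {perm T}) : max_cycle_length a <= #|T|.
Proof. by apply: max_cycle_length_le => x; apply: max_card. Qed.

Lemma AutTP (gT : finGroupType) (a : {perm gT}) :
  reflect {morph a : u v / u * v} (a \in Aut [set: gT]).
Proof.
rewrite inE; apply: (iffP andP) => [[_ /morphicP aM] u v|aM].
  by rewrite aM ?inE.
split; last by apply/morphicP=> u v _ _; apply: aM.
by apply/subsetP=> u _; rewrite inE.
Qed.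

Definition prime_power q := exists p k, [/\ prime p, 0 < k & q = (p ^ k)%N].

Lemma large_cycle_orders (gT : finGroupType) (a : {perm gT}) :
  a \in Aut [set: gT] -> #|gT| < 2 * max_cycle_length a ->
  exists s : seq nat, [/\ forall q, q \in s -> 2 < q /\ prime_power q,
    pairwise (fun q q' => coprime q.-1 q'.-1) s &
    (max_cycle_length a * \prod_(q <- s) q = #|gT| * \prod_(q <- s) q.-1)%N].
Proof.
move/AutTP=> aM; have [x ->] := max_cycle_length_attained a (1 : gT) => Lx.
have cT := large_orbit_abelian aM Lx.
exists (map (@quotient_order gT) (enum (max_invariant a))); split.
- move=> q /mapP[M]; rewrite mem_enum => maxM ->.
  by split; [apply: (index_gt2 aM cT Lx) | apply: (index_prime_power aM cT Lx)].
- rewrite pairwise_map; apply: (@sub_in_pairwise _ (mem (max_invariant a)) [rel M M' | M != M']).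
  + by move=> M M' maxM maxM' ne; apply: (index_coprime aM cT Lx).
  + by apply/allP => M; rewrite mem_enum.
  by rewrite -uniq_pairwise enum_uniq.
by rewrite !big_map !big_enum; apply: max_invariant_prod.
Qed.

Lemma field_automorphism q : prime_power q ->
  exists (gT : finGroupType) (a : {perm gT}),
    [/\ a \in Aut [set: gT], #|gT| = q & max_cycle_length a = q.-1].
Proof.
case=> p [k [p_pr k_gt0 ->]]; have [F _ cardF] := pPrimePowerField p_pr k_gt0.
have /cyclicP[u uE] : cyclic [set: {unit F}] by apply: field_unit_group_cyclic.
pose f (y : F) := (y * FinRing.uval u)%R.
have fI : injective f.
  by move=> y z; apply: mulIr; apply: valP u.
exists F, (perm fI); have fX i y : (perm fI ^+ i) y = (y * FinRing.uval u ^+ i)%R.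
  elim: i y => [|i IHi] y; first by rewrite perm1 expr0 mulr1.
  by rewrite expgSr permM IHi permE /f exprSr mulrA.
split=> //.
  by apply/AutTP => y z; rewrite !permE /f mulrDl.
have orb1 : porbit (perm fI) (1%R : F) = [set y | y != 0%R].
  apply/setP=> y; rewrite inE; apply/porbitP/idP => [[i ->]|].
    by rewrite fX mul1r -FinRing.val_unitX -unitfE; apply: (valP (u ^+ i)).
  rewrite -unitfE => Uy; have : FinRing.unit F Uy \in <[u]> by rewrite -uE inE.
  case/cycleP=> i /(congr1 FinRing.uval) yE; exists i.
  by rewrite fX mul1r -FinRing.val_unitX; exact: yE.
apply/eqP; rewrite eqn_leq; apply/andP; split.
  apply: max_cycle_length_le => y; have [-> | ny] := eqVneq y 0%R.
    have -> : porbit (perm fI) (0%R : F) = [set 0%R].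
      apply/setP=> y0; rewrite inE; apply/porbitP/eqP => [[i ->]|->].
        by rewrite fX mul0r.
      by exists 0; rewrite fX mul0r.
    rewrite cards1; case: k k_gt0 {cardF} => // k _.
    have := prime_gt1 p_pr; have : 0 < p ^ k by rewrite expn_gt0 prime_gt0.
    rewrite expnS; nia.
  have -> : porbit (perm fI) y = porbit (perm fI) (1%R : F).
    by apply/eqP; rewrite eq_porbit_mem orb1 inE.
  by rewrite orb1 -cardF -(cardC1 (0%R : F)) cardsE.
apply: leq_trans (card_porbit_le_max _ (1%R : F)).
by rewrite orb1 -cardF -(cardC1 (0%R : F)) cardsE.
Qed.

(** A cycle of the product map lies in a product of two cycles. For a pair of points on longest
    cycles both lengths divide its length, and by coprimality so does their product. *)
Lemma product_automorphism (gT1 gT2 : finGroupType) (a1 : {perm gT1}) (a2 : {perm gT2}) :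
  a1 \in Aut [set: gT1] -> a2 \in Aut [set: gT2] ->
  coprime (max_cycle_length a1) (max_cycle_length a2) ->
  exists (gT : finGroupType) (a : {perm gT}),
    [/\ a \in Aut [set: gT], #|gT| = (#|gT1| * #|gT2|)%N &
        max_cycle_length a = (max_cycle_length a1 * max_cycle_length a2)%N].
Proof.
move=> /AutTP a1M /AutTP a2M co.
pose f (u : gT1 * gT2) := (a1 u.1, a2 u.2).
have fI : injective f by move=> [u1 u2] [v1 v2] [/perm_inj-> /perm_inj->].
exists (gT1 * gT2)%type, (perm fI).
have fX i u : (perm fI ^+ i) u = ((a1 ^+ i) u.1, (a2 ^+ i) u.2).
  elim: i u => [|i IHi] u; first by rewrite !perm1 -surjective_pairing.
  by rewrite !expgSr !permM IHi permE.
split; first by apply/AutTP => u v; rewrite !permE /f /= a1M a2M.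
  by rewrite card_prod.
apply/eqP; rewrite eqn_leq; apply/andP; split.
  apply: max_cycle_length_le => u.
  apply: (@leq_trans #|setX (porbit a1 u.1) (porbit a2 u.2)|).
    apply/subset_leq_card/subsetP => v /porbitP[i ->].
    by rewrite fX inE !mem_porbit.
  by rewrite cardsX leq_mul ?card_porbit_le_max.
have [x1 E1] := max_cycle_length_attained a1 (1 : gT1).
have [x2 E2] := max_cycle_length_attained a2 (1 : gT2).
apply: leq_trans (card_porbit_le_max _ (x1, x2)).
apply: dvdn_leq; first by rewrite lt0n card_porbit_neq0.
rewrite Gauss_dvd // E1 E2 -!dvdn_card_porbit.
have := dvdnn #|porbit (perm fI) (x1, x2)|.
by rewrite -dvdn_card_porbit fX /= => /eqP[-> ->]; rewrite !eqxx.
Qed.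

Lemma realize_orders (s : seq nat) :
  (forall q, q \in s -> prime_power q) ->
  pairwise (fun q q' => coprime q.-1 q'.-1) s ->
  exists (gT : finGroupType) (a : {perm gT}),
    [/\ a \in Aut [set: gT], #|gT| = (\prod_(q <- s) q)%N &
        max_cycle_length a = (\prod_(q <- s) q.-1)%N].
Proof.
elim: s => [_ _|q s IHs ppq /= /andP[/allP cq cs]].
  (* The symmetric group on one letter serves as the trivial group. *)
  exists {perm 'I_1}, 1; have card1 : #|{: {perm 'I_1}}| = 1%N by rewrite card_Sn.
  have := max_cycle_length_le_card (1 : {perm {perm 'I_1}}); rewrite card1 => le1.
  rewrite !big_nil group1; split=> //; apply/eqP.
  by rewrite eqn_leq le1 (max_cycle_length_gt0 _ (1 : {perm 'I_1})).
have [|gT [a [aA cardT maxT]]] := IHs _ cs; first by move=> r rs; apply: ppq; rewrite inE rs orbT.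
have [gT' [a' [aA' cardT' maxT']]] := field_automorphism (ppq q (mem_head _ _)).
have [|gT2 [a2 [aA2 cardT2 maxT2]]] := product_automorphism aA' aA.
  rewrite maxT maxT' big_seq; elim/big_rec: _ => [|r n rs IH]; first exact: coprimen1.
  by rewrite coprimeMr cq.
by exists gT2, a2; rewrite aA2 cardT2 maxT2 cardT cardT' maxT maxT' !big_cons.
Qed.

Lemma odd_pred_expn2 m : odd (2 ^ m.+1)%N.-1.
Proof. by rewrite -[odd _]negbK -oddS prednK ?expn_gt0 // oddX. Qed.

(* With [o] the odd part of the cycle length and [totient o %| m.-1],
   [2 ^ m - 1 = 1] modulo [o]. *)
Lemma coprime_pred_expn2_totient l n : 0 < l ->
  coprime l (2 ^ (n * totient (l`_(2^'))%N).+1).-1.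
Proof.
move=> l_gt0; set o := (l`_(2^'))%N; set m := (n * totient o).+1.
have odd_o : coprime 2 o by rewrite prime_coprime // -p'natE // part_pnat.
have mod1 : (2 ^ m).-1 = 1 %[mod o].
  have e : 2 ^ m = 2 %[mod o].
    rewrite /m expnS -modnMmr [(n * _)%N]mulnC expnM -modnXm (Euler_exp_totient odd_o).
    by rewrite modnXm exp1n modnMmr muln1.
  apply/eqP; rewrite -(eqn_modDr 1) addn1 prednK ?expn_gt0 //; exact/eqP.
rewrite -(partnC 2 l_gt0) coprimeMl; apply/andP; split.
  by rewrite p_part coprimeXl // coprime2n odd_pred_expn2.
by rewrite -coprime_modr mod1 coprime_modr coprimen1.
Qed.

End LargeCycles.

(** * Arithmetic of the cycle ratios above 1/2 *)

(** The subtractive Euclidean algorithm acts on the exponents: modulo 2^m - 1, the number 2^n - 1 is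
    2^(n - m) - 1 for m <= n. *)
Lemma coprime_pred_expn2 m n : 0 < m -> coprime (2 ^ m).-1 (2 ^ n).-1 = coprime m n.
Proof.
suff gcdE : gcdn (2 ^ m).-1 (2 ^ n).-1 = (2 ^ gcdn m n).-1.
  move=> m_gt0; rewrite /coprime gcdE; have : 0 < gcdn m n by rewrite gcdn_gt0 m_gt0.
  case: (gcdn m n) => [|[|g]] // _; apply/negbTE.
  by have : 4 <= 2 ^ g.+2 by [rewrite (@leq_exp2l 2 2)]; case: (2 ^ _) => [|[|[|]]].
have [k] := ubnP (m + n); elim: k m n => // k IHk m n.
wlog le_mn : m n / m <= n => [IH|lt_k].
  have [|/ltnW le_nm lt_k] := leqP m n; first exact: IH.
  by rewrite gcdnC [gcdn m n]gcdnC IH // addnC.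
have [-> | m_gt0] := posnP m; first by rewrite !gcd0n.
have -> : (2 ^ n).-1 = (2 ^ m).-1 * 2 ^ (n - m) + (2 ^ (n - m)).-1.
  rewrite -[in LHS](subnKC le_mn) expnD; have := expn_gt0 2 m; have := expn_gt0 2 (n - m).
  by move: (2 ^ m) (2 ^ (n - m)) => [|u] [|v] //= _ _; lia.
rewrite mulnC gcdnMDl IHk; last by rewrite subnKC //; lia.
by rewrite -{2}(subnKC le_mn) gcdnDl.
Qed.

(** * Pairwise coprime exponents *)

Definition coprime_exponents (ms : seq nat) :=
  all (fun m => 1 < m) ms && pairwise coprime ms.

Lemma pairwise_in (T : eqType) (r : rel T) (s : seq T) x y :
  symmetric r -> pairwise r s -> x \in s -> y \in s -> x != y -> r x y.
Proof.
move=> rC; elim: s => //= z s IHs /andP[/allP rz rs].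
rewrite !inE => /orP[/eqP-> | xs] /orP[/eqP-> | ys]; rewrite ?eqxx //.
- by rewrite rz.
- by rewrite rC rz.
exact: IHs.
Qed.

Section CoprimeExponents.

Variable ms : seq nat.
Hypothesis wf : coprime_exponents ms.

Lemma coprime_exponents_gt1 m : m \in ms -> 1 < m.
Proof. by case/andP: wf => /allP gt1 _; apply: gt1. Qed.

Lemma coprime_exponentsP m n : m \in ms -> n \in ms -> m != n -> coprime m n.
Proof. by case/andP: wf => _; apply: pairwise_in; apply: coprime_sym. Qed.

Lemma coprime_exponents_uniq : uniq ms.
Proof.
move: wf; rewrite /coprime_exponents; elim: ms => //= m s IHs /andP[/andP[m_gt1 gt1] /andP[cm cs]].
rewrite IHs ?gt1 ?cs // andbT; apply/negP => /(allP cm).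
by rewrite /coprime gcdnn => /eqP m1; rewrite m1 in m_gt1.
Qed.

Lemma coprime_exponents_pdiv_uniq : uniq (map pdiv ms).
Proof.
rewrite map_inj_in_uniq ?coprime_exponents_uniq // => m n ms_m ms_n eq_pdiv.
apply/eqP/negPn/negP => ne_mn; have := coprime_exponentsP ms_m ms_n ne_mn.
have pr := pdiv_prime (coprime_exponents_gt1 ms_m).
have : pdiv m %| gcdn m n by rewrite dvdn_gcd pdiv_dvd eq_pdiv pdiv_dvd.
rewrite /coprime => /[swap] /eqP ->; rewrite dvdn1 => /eqP p1.
by rewrite p1 in pr.
Qed.

End CoprimeExponents.

(** Two odd orders would have even predecessors, so at most one is odd. An even prime power is a
    power of 2, and being greater than 2 it has exponent at least 2. *)
Lemma split_coprime_orders (s : seq nat) :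
  (forall q, q \in s -> 2 < q /\ exists p k, prime p /\ q = p ^ k) ->
  pairwise (fun q q' => coprime q.-1 q'.-1) s ->
  exists2 ms, coprime_exponents ms &
    perm_eq s (map (expn 2) ms) \/
    exists q0, [/\ odd q0, 2 < q0, perm_eq s (q0 :: map (expn 2) ms) &
                   forall m, m \in ms -> coprime q0.-1 (2 ^ m).-1].
Proof.
elim: s => [_ _|q s IHs ppq /= /andP[/allP cq cs]]; first by exists [::] => //; left.
have [||ms wf IH] := IHs => //; first by move=> r rs; apply: ppq; rewrite inE rs orbT.
have [q_gt2 [p [k [p_pr qE]]]] := ppq q (mem_head _ _).
have [odd_q | even_q] := boolP (odd q).
  exists ms => //; right; case: IH => [eq_s | [q0 [odd_q0 q0_gt2 eq_s _]]].
    exists q; split=> //; first by rewrite perm_cons.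
    by move=> m ms_m; apply: cq; rewrite (perm_mem eq_s) map_f.
  have := cq q0; rewrite (perm_mem eq_s) mem_head => /(_ isT).
  have : 2 %| gcdn q.-1 q0.-1 by rewrite dvdn_gcd !dvdn2; lia.
  by rewrite /coprime => /[swap] /eqP->.
have p2 : p = 2.
  move: even_q; rewrite qE oddX negb_or => /andP[_ even_p].
  by case: (even_prime p_pr) => // odd_p; rewrite odd_p in even_p.
subst p; have k_gt1 : 1 < k by move: q_gt2; rewrite qE; case: k {qE} => [|[|]].
have cm q' : q' \in s -> coprime (2 ^ k).-1 q'.-1 by rewrite -qE; apply: cq.
have wf' : coprime_exponents (k :: ms).
  rewrite /coprime_exponents /= k_gt1 /=; case/andP: wf => -> ->; rewrite andbT /=.
  apply/allP=> m ms_m; rewrite -coprime_pred_expn2; last exact: ltnW.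
  by apply: cm; case: IH => [eq_s | [q0 [_ _ eq_s _]]]; rewrite (perm_mem eq_s) ?inE map_f ?orbT.
exists (k :: ms) => //; case: IH => [eq_s | [q0 [odd_q0 q0_gt2 eq_s cq0]]].
  by left; rewrite qE /= perm_cons.
right; exists q0; split=> //.
  rewrite qE (perm_trans (y := [:: 2 ^ k, q0 & map (expn 2) ms])) ?perm_cons //=.
  by rewrite -[_ :: _ :: _]/([:: 2 ^ k] ++ [:: q0] ++ _) perm_catCA.
move=> m; rewrite inE => /orP[/eqP-> | ]; last exact: cq0.
by rewrite coprime_sym cm // (perm_mem eq_s) mem_head.
Qed.

(** The cofactor of the least prime factor is a divisor greater than 1, so it is no smaller than
    that prime. *)
Lemma pdiv_sqr_le m : 1 < m -> m != pdiv m -> pdiv m ^ 2 <= m.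
Proof.
move=> m_gt1 ne; have /dvdnP[k mE] := pdiv_dvd m.
have k_gt1 : 1 < k.
  case: k mE => [|[|k]] // mE; first by rewrite mE in m_gt1.
  by case/negP: ne; apply/eqP; rewrite {1}mE mul1n.
have : pdiv m <= k by apply: pdiv_min_dvd => //; rewrite mE dvdn_mulr.
by move=> le; rewrite {2}mE expnS expn1 leq_mul2r le orbT.
Qed.

Local Open Scope ring_scope.

(** * Products of the factors 1 - 1 / 2^m *)

Section MersenneProducts.

Variable R : realFieldType.

Definition mersenne_prod (ms : seq nat) : R := \prod_(m <- ms) (1 - 1 / 2 ^+ m).

Lemma mersenne_factor_ge0 m : 0 <= 1 - 1 / 2 ^+ m :> R.
Proof. by rewrite subr_ge0 ler_pdivrMr ?exprn_gt0 // mul1r exprn_ege1 // ler1n. Qed.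

Lemma mersenne_factor_gt0 m : (0 < m)%N -> 0 < 1 - 1 / 2 ^+ m :> R.
Proof.
case: m => // m _; rewrite subr_gt0 ltr_pdivrMr ?exprn_gt0 // mul1r.
by rewrite exprn_egt1 // ltr1n.
Qed.

Lemma mersenne_factor_le1 m : 1 - 1 / 2 ^+ m <= 1 :> R.
Proof. by rewrite gerBl divr_ge0 ?exprn_ge0. Qed.

Lemma mersenne_factor_le m n : (m <= n)%N -> 1 - 1 / 2 ^+ m <= 1 - 1 / 2 ^+ n :> R.
Proof.
move=> le_mn; rewrite lerD2l lerN2 !mul1r lef_pV2 ?posrE ?exprn_gt0 //.
by rewrite ler_weXn2l // ler1n.
Qed.

Lemma mersenne_prod_ge0 ms : 0 <= mersenne_prod ms.
Proof. by apply: prodr_ge0 => m _; apply: mersenne_factor_ge0. Qed.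

Lemma mersenne_prod_le1 ms : mersenne_prod ms <= 1.
Proof.
by apply: prodr_ile1 => m _; rewrite mersenne_factor_ge0 mersenne_factor_le1.
Qed.

Lemma mersenne_prod_perm ms ns : perm_eq ms ns -> mersenne_prod ms = mersenne_prod ns.
Proof. exact: perm_big. Qed.

Lemma mersenne_prod_cat ms ns :
  mersenne_prod (ms ++ ns) = mersenne_prod ms * mersenne_prod ns.
Proof. exact: big_cat. Qed.

Lemma mersenne_prod_sub ms ns : uniq ms -> uniq ns -> {subset ns <= ms} ->
  mersenne_prod ms <= mersenne_prod ns.
Proof.
move=> ums uns sub; rewrite -(mersenne_prod_perm (permEl (perm_filterC (mem ns) ms))).
rewrite mersenne_prod_cat.
have -> : mersenne_prod (filter (mem ns) ms) = mersenne_prod ns.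
  apply: mersenne_prod_perm; apply: uniq_perm; rewrite ?filter_uniq // => m.
  by rewrite mem_filter; apply: andb_idr; apply: sub.
by rewrite ler_piMr ?mersenne_prod_ge0 ?mersenne_prod_le1.
Qed.

(* Distinct members of [ms] have distinct least prime factors. *)
Lemma mersenne_prod_lower (B : nat -> nat) N ms : coprime_exponents ms ->
  (forall m, m \in ms -> (B (pdiv m) <= m)%N) ->
  (forall m, m \in ms -> (m < N)%N) ->
  mersenne_prod [seq B p | p <- index_iota 0 N & prime p] <= mersenne_prod ms.
Proof.
move=> wf leB ltN; have gt1 := coprime_exponents_gt1 wf.
apply: (@le_trans _ _ (mersenne_prod (map B (map pdiv ms)))); last first.
  rewrite /mersenne_prod !big_map big_seq [leRHS]big_seq; apply: ler_prod => m ms_m.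
  by rewrite mersenne_factor_ge0 mersenne_factor_le ?leB.
set ps := filter _ _; have ups : uniq ps by apply: filter_uniq; apply: iota_uniq.
have sub : {subset map pdiv ms <= ps}.
  move=> _ /mapP[m ms_m ->]; rewrite mem_filter pdiv_prime ?gt1 // mem_index_iota /=.
  by apply: leq_ltn_trans (ltN m ms_m); apply: dvdn_leq (pdiv_dvd m); apply: ltnW (gt1 m ms_m).
have /(perm_map B)/mersenne_prod_perm <- := permEl (perm_filterC (mem (map pdiv ms)) ps).
rewrite map_cat mersenne_prod_cat.
suff /mersenne_prod_perm -> : perm_eq (map B (filter (mem (map pdiv ms)) ps)) (map B (map pdiv ms)).
  by rewrite ler_piMr ?mersenne_prod_ge0 ?mersenne_prod_le1.
apply/perm_map/uniq_perm; rewrite ?(filter_uniq _ ups) ?coprime_exponents_pdiv_uniq // => p.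
by rewrite mem_filter; apply: andb_idr; apply: sub.
Qed.

End MersenneProducts.

(** * The gaps above 1/2 and 3/4 *)

Section Gaps.

Variables (R : realFieldType) (ms : seq nat) (P : R).
Hypotheses (wf : coprime_exponents ms) (P_ge0 : 0 <= P).
Hypothesis P_lt : forall N, P < \prod_(11 <= p < N | prime p) (1 - 1 / 2 ^+ p).

Local Notation M := (mersenne_prod R ms).

Let gt1 := coprime_exponents_gt1 wf.

Definition small_prod (b2 b3 b5 b7 : nat) : R :=
  (1 - 1 / 2 ^+ b2) * (1 - 1 / 2 ^+ b3) * (1 - 1 / 2 ^+ b5) * (1 - 1 / 2 ^+ b7).

(* The [b]s bound from below the members with least prime factor 2, 3, 5, 7. *)
Definition small_bound (b2 b3 b5 b7 : nat) := forall m, m \in ms ->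
  [/\ (~~ odd m -> b2 <= m)%N, (pdiv m = 3 -> b3 <= m)%N,
      (pdiv m = 5 -> b5 <= m)%N & (pdiv m = 7 -> b7 <= m)%N].

(** An instance of [mersenne_prod_lower] in which the four smallest primes get the given bounds and
    every larger prime bounds itself. Strictness comes from [P_lt]. *)
Lemma mersenne_prod_small b2 b3 b5 b7 (c r : R) :
  (0 < b2)%N -> (0 < b3)%N -> (0 < b5)%N -> (0 < b7)%N -> small_bound b2 b3 b5 b7 ->
  0 < c -> r <= c * small_prod b2 b3 b5 b7 -> r * P < c * M.
Proof.
move=> b2_gt0 b3_gt0 b5_gt0 b7_gt0 bnd c_gt0 le_r.
have T_gt0 : 0 < small_prod b2 b3 b5 b7 by rewrite !mulr_gt0 ?mersenne_factor_gt0.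
pose B (p : nat) := if p == 2%N then b2 else if p == 3%N then b3 else
  if p == 5%N then b5 else if p == 7%N then b7 else p.
pose N := (12 + \max_(m <- ms) m)%N.
have leB m : m \in ms -> (B (pdiv m) <= m)%N.
  move=> ms_m; have [h2 h3 h5 h7] := bnd m ms_m; rewrite /B.
  case: ifP => [/eqP p2|_]; first by apply: h2; rewrite -dvdn2 -p2 pdiv_dvd.
  do 3?[case: ifP => [/eqP ? |_]; first by auto].
  by rewrite dvdn_leq ?pdiv_dvd // ltnW ?gt1.
have ltN m : m \in ms -> (m < N)%N.
  move=> ms_m; rewrite /N addSn ltnS.
  by rewrite (leq_trans (@leq_bigmax_seq _ ms xpredT id m ms_m isT)) ?leq_addl.
have := mersenne_prod_lower R wf leB ltN.
have -> : index_iota 0 N = iota 0 11 ++ index_iota 11 N.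
  by rewrite /index_iota subn0 -iotaD subnKC.
rewrite filter_cat map_cat mersenne_prod_cat /=.
have -> : mersenne_prod R [seq B p | p <- index_iota 11 N & prime p] =
    \prod_(11 <= p < N | prime p) (1 - 1 / 2 ^+ p).
  rewrite /mersenne_prod big_map big_filter big_seq_cond [RHS]big_seq_cond.
  apply: eq_bigr => p /andP[]; rewrite mem_index_iota /B => /andP[p_ge11 _] _.
  by do 4?[case: eqP => [E|_]; first by rewrite E in p_ge11].
have -> : mersenne_prod R [seq B p | p <- [:: 2; 3; 5; 7]%N] = small_prod b2 b3 b5 b7.
  by rewrite /mersenne_prod !big_cons big_nil mulr1 !mulrA.
move=> le_M; apply: (@lt_le_trans _ _ (c * (small_prod b2 b3 b5 b7 *
   \prod_(11 <= p < N | prime p) (1 - 1 / 2 ^+ p)))); last by rewrite ler_pM2l.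
apply: (@le_lt_trans _ _ (c * small_prod b2 b3 b5 b7 * P)); first by rewrite ler_wpM2r.
by rewrite mulrA ltr_pM2l ?P_lt // mulr_gt0.
Qed.

Lemma mersenne_prod_le_sub ns : uniq ns -> {subset ns <= ms} -> M <= mersenne_prod R ns.
Proof. exact/mersenne_prod_sub/coprime_exponents_uniq. Qed.

Lemma mersenne_prod_le1in m : m \in ms -> M <= 1 - 1 / 2 ^+ m.
Proof.
move=> ms_m; have := @mersenne_prod_le_sub [:: m] isT.
rewrite /mersenne_prod big_cons big_nil mulr1; apply.
by move=> k; rewrite inE => /eqP->.
Qed.

Lemma mersenne_prod_le2in m n : m != n -> m \in ms -> n \in ms ->
  M <= (1 - 1 / 2 ^+ m) * (1 - 1 / 2 ^+ n).
Proof.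
move=> ne ms_m ms_n; have := @mersenne_prod_le_sub [:: m; n].
rewrite /mersenne_prod !big_cons big_nil mulr1; apply; first by rewrite /= inE ne.
by move=> k; rewrite !inE => /orP[]/eqP->.
Qed.

Lemma mersenne_prod_le3in m n k : uniq [:: m; n; k] -> m \in ms -> n \in ms -> k \in ms ->
  M <= (1 - 1 / 2 ^+ m) * (1 - 1 / 2 ^+ n) * (1 - 1 / 2 ^+ k).
Proof.
move=> u ms_m ms_n ms_k; have := mersenne_prod_le_sub u.
rewrite /mersenne_prod !big_cons big_nil mulr1 mulrA; apply.
by move=> l; rewrite !inE => /or3P[]/eqP->.
Qed.

(** If the prime p itself is not a member, a member with least prime factor p is at least its
    square, by [pdiv_sqr_le]. *)
Lemma small_bound_intro (b2 b3 b5 b7 : nat) :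
  (forall m, m \in ms -> ~~ odd m -> b2 <= m)%N ->
  (b3 = 3%N \/ (b3 <= 9)%N /\ 3%N \notin ms) ->
  (b5 = 5%N \/ (b5 <= 25)%N /\ 5%N \notin ms) ->
  (b7 = 7%N \/ (b7 <= 49)%N /\ 7%N \notin ms) -> small_bound b2 b3 b5 b7.
Proof.
have bound p b m : m \in ms -> pdiv m = p ->
    b = p \/ (b <= p ^ 2)%N /\ p \notin ms -> (b <= m)%N.
  move=> ms_m pE [->|[le nms]]; first by rewrite -pE dvdn_leq ?pdiv_dvd // ltnW ?gt1.
  apply: leq_trans le _; rewrite -pE pdiv_sqr_le ?gt1 // pE.
  by apply: contraNneq nms => <-.
move=> h2 h3 h5 h7 m ms_m; split; first exact: h2.
- by move/(bound _ _ _ ms_m); apply.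
- by move/(bound _ _ _ ms_m); apply.
- by move/(bound _ _ _ ms_m); apply.
Qed.

Lemma even_ge2 m : m \in ms -> ~~ odd m -> (2 <= m)%N.
Proof. by move=> /gt1. Qed.

Lemma even_ge4 : 2%N \notin ms -> forall m, m \in ms -> ~~ odd m -> (4 <= m)%N.
Proof.
move=> n2 m ms_m; have := gt1 ms_m; have : m != 2%N by apply: contraNneq n2 => <-.
by case: m {ms_m} => [|[|[|[|]]]].
Qed.

Lemma even_ge6 : 2%N \notin ms -> 4%N \notin ms -> forall m, m \in ms -> ~~ odd m -> (6 <= m)%N.
Proof.
move=> n2 n4 m ms_m om; have := even_ge4 n2 ms_m om; have : m != 4%N by apply: contraNneq n4 => <-.
by case: m om {ms_m} => [|[|[|[|[|[|]]]]]].
Qed.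

Lemma even_ge8 : 2%N \notin ms -> 4%N \notin ms -> 3%N \in ms ->
  forall m, m \in ms -> ~~ odd m -> (8 <= m)%N.
Proof.
move=> n2 n4 ms3 m ms_m om; have := even_ge6 n2 n4 ms_m om.
have : m != 6%N.
  apply/eqP => m6; subst m; have := coprime_exponentsP wf ms3 ms_m isT.
  by [].
by case: m om {ms_m} => [|[|[|[|[|[|[|[|]]]]]]]].
Qed.

(** The factor contributed by the single odd order, or 1 when all orders are powers of 2. *)
Definition cofactor (c : R) := c = 1 \/ exists q0 : nat,
  [/\ odd q0, (2 < q0)%N, c = 1 - 1 / q0%:R &
      forall m, m \in ms -> coprime q0.-1 (2 ^ m).-1].

(** Only [q0 = 3] gives a cofactor below 4/5. There the exponent 2 would bring the ratio down to 2/3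
    * 3/4 = 1/2, and without it 2/3 * 15/16 exceeds 4/5 * 3/4. *)
Lemma gap_half c : cofactor c -> 1 / 2 < c * M ->
  4 / 5 * small_prod 2 3 5 7 * P < c * M.
Proof.
have M_ge0 := mersenne_prod_ge0 R ms.
case=> [-> _|[q0 [odd_q0 q0_gt2 -> cq]]].
  apply: (@mersenne_prod_small 2 3 5 7) => //.
    by apply: small_bound_intro; [exact: even_ge2 | left|left|left].
  by rewrite /small_prod; lra.
have [-> | q0_neq3] := eqVneq q0 3%N.
  move=> gt12; have n2 : 2%N \notin ms by apply/negP => /mersenne_prod_le1in; lra.
  apply: (@mersenne_prod_small 4 3 5 7) => //; last by rewrite /small_prod; lra.
    by apply: small_bound_intro; [exact: even_ge4 | left|left|left].
  by lra.
have q0_ge5 : (5 <= q0)%N by move: odd_q0 q0_gt2 q0_neq3; case: q0 {cq} => [|[|[|[|[|]]]]].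
have c_ge : 4 / 5 <= 1 - 1 / q0%:R :> R.
  have -> : 4 / 5 = 1 - 1 / 5 :> R by lra.
  by rewrite lerD2l lerN2 !mul1r lef_pV2 ?posrE ?ltr0n // ?ler_nat //; lia.
move=> _; apply: (@mersenne_prod_small 2 3 5 7) => //.
- by apply: small_bound_intro; [exact: even_ge2 | left|left|left].
- by lra.
by apply: ler_wpM2r c_ge; rewrite !mulr_ge0 ?mersenne_factor_ge0.
Qed.

(** Dropping the factor with exponent 49 gives a slightly larger target with small numerals, which
    every case but the extremal one still meets. *)
Lemma small_prod_target_le :
  8 / 9 * small_prod 8 3 5 49 <= 8 / 9 * (255 / 256 * (7 / 8) * (31 / 32)).
Proof.
rewrite ler_pM2l; last by lra.
have -> : 255 / 256 * (7 / 8) * (31 / 32) =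
   (1 - 1 / 2 ^+ 8) * (1 - 1 / 2 ^+ 3) * (1 - 1 / 2 ^+ 5) :> R by lra.
by rewrite /small_prod ler_piMr ?mersenne_factor_le1 // !mulr_ge0 ?mersenne_factor_ge0.
Qed.

Lemma gap_three_quarters_step b2 b3 b5 b7 (c d : R) :
  (0 < b2)%N -> (0 < b3)%N -> (0 < b5)%N -> (0 < b7)%N -> small_bound b2 b3 b5 b7 ->
  0 < d -> d <= c -> 8 / 9 * (255 / 256 * (7 / 8) * (31 / 32)) <= d * small_prod b2 b3 b5 b7 ->
  8 / 9 * small_prod 8 3 5 49 * P < c * M.
Proof.
move=> b2_gt0 b3_gt0 b5_gt0 b7_gt0 bnd d_gt0 le_dc le_r.
apply: (mersenne_prod_small b2_gt0 b3_gt0 b5_gt0 b7_gt0) => //; first exact: lt_le_trans le_dc.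
apply: le_trans small_prod_target_le _; apply: le_trans le_r _.
by apply: ler_wpM2r le_dc; rewrite !mulr_ge0 ?mersenne_factor_ge0.
Qed.

(** The extremal order 9. The exponent 2 is too costly; lacking 3 or 5 leaves the product above the
    target; with 3 present, 4 is too costly and 6 is not coprime to 3; with 3 and 5 present, 7 is
    too costly. What remains are the exponents of the target. *)
Lemma gap_three_quarters_9 : 3 / 4 < 8 / 9 * M -> 8 / 9 * small_prod 8 3 5 49 * P < 8 / 9 * M.
Proof.
move=> gt34; have n2 : 2%N \notin ms by apply/negP => /mersenne_prod_le1in; lra.
have [ms3 | n3] := boolP (3%N \in ms); last first.
  apply: (@gap_three_quarters_step 4 9 5 7 _ (8 / 9)) => //; rewrite ?/small_prod; try lra.
  by apply: small_bound_intro; [exact: even_ge4 | right | left | left].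
have n4 : 4%N \notin ms by apply/negP => /(mersenne_prod_le2in (isT : 3%N != 4%N) ms3); lra.
have ge8 := even_ge8 n2 n4 ms3.
have [ms5 | n5] := boolP (5%N \in ms); last first.
  apply: (@gap_three_quarters_step 8 3 25 7 _ (8 / 9)) => //; rewrite ?/small_prod; try lra.
  by apply: small_bound_intro; [exact: ge8 | left | right | left].
have n7 : 7%N \notin ms.
  by apply/negP => /(mersenne_prod_le3in (isT : uniq [:: 3; 5; 7]%N) ms3 ms5); lra.
apply: (@mersenne_prod_small 8 3 5 49) => //; last by lra.
by apply: small_bound_intro; [exact: ge8 | left | left | right].
Qed.

Lemma gap_three_quarters c : cofactor c -> 3 / 4 < c * M ->
  8 / 9 * small_prod 8 3 5 49 * P < c * M.
Proof.
have M_ge0 := mersenne_prod_ge0 R ms; have M_le1 := mersenne_prod_le1 R ms.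
case=> [-> gt34|[q0 [odd_q0 q0_gt2 -> cq]]].
  have n2 : 2%N \notin ms by apply/negP => /mersenne_prod_le1in; lra.
  apply: (@gap_three_quarters_step 4 3 5 7 _ 1) => //; rewrite ?/small_prod; try lra.
  by apply: small_bound_intro; [exact: even_ge4 | left | left | left].
have c_le1 : 1 - 1 / q0%:R <= 1 :> R by rewrite gerBl divr_ge0.
move=> gt34.
have le2 : 2%N \in ms -> 3 / 4 < (1 - 1 / q0%:R) * (3 / 4) :> R.
  move/mersenne_prod_le1in => le; apply: lt_le_trans gt34 _.
  apply: ler_wpM2l; last by lra.
  by rewrite subr_ge0 mul1r invf_le1 ?ler1n ?ltr0n; lia.
have n2 : 2%N \notin ms by apply/negP => /le2; lra.
have [lt23 | ge23] := ltnP q0 23; last first.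
  (* From 23 on the cofactor is so close to 1 that excluding the exponent 2 suffices. *)
  apply: (@gap_three_quarters_step 4 3 5 7 _ (22 / 23)) => //.
  - by apply: small_bound_intro; [exact: even_ge4 | left | left | left].
  - by lra.
  - have -> : 22 / 23 = 1 - 1 / 23 :> R by lra.
    by rewrite lerD2l lerN2 !mul1r lef_pV2 ?posrE ?ltr0n // ?ler_nat //; lia.
  by rewrite /small_prod; lra.
(* The values 15 and 21 appear because [cofactor] asks only for an odd number. *)
have : q0 \in [:: 3; 5; 7; 9; 11; 13; 15; 17; 19; 21]%N.
  by move: odd_q0 q0_gt2 lt23; clear; do 23?[case: q0 => [|q0] //].
rewrite !inE => /or4P[/eqP E|/eqP E|/eqP E|]; first 3 last.
  case/or4P=> [/eqP E|/eqP E|/eqP E|]; first 3 last.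
    case/or4P=> [/eqP E|/eqP E|/eqP E|/eqP E]; move: gt34 cq {le2 c_le1}; rewrite E /= => gt34 cq.
    (* For 15: the predecessor 14 shares the factor 7 with 2^3 - 1. Likewise 10, 12, 18 and 20 below
       each share a factor with 2^4 - 1 = 15. *)
    - have n3 : 3%N \notin ms by apply/negP => /cq.
      apply: (@gap_three_quarters_step 4 9 5 7 _ (14 / 15)) => //; rewrite ?/small_prod; try lra.
      by apply: small_bound_intro; [exact: even_ge4 | right | left | left].
    (* For 17 the predecessor 16 is coprime to all 2^m - 1, so only size helps: the exponents 3, 4
       and 5 together push the ratio below 3/4. *)
    - have [ms4 | n4] := boolP (4%N \in ms); last first.
        apply: (@gap_three_quarters_step 6 3 5 7 _ (16 / 17)) => //; rewrite ?/small_prod; try lra.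
        by apply: small_bound_intro; [exact: even_ge6 | left | left | left].
      have [ms3 | n3] := boolP (3%N \in ms); last first.
        apply: (@gap_three_quarters_step 4 9 5 7 _ (16 / 17)) => //; rewrite ?/small_prod; try lra.
        by apply: small_bound_intro; [exact: even_ge4 | right | left | left].
      have n5 : 5%N \notin ms.
        by apply/negP => /(mersenne_prod_le3in (isT : uniq [:: 4; 3; 5]%N) ms4 ms3); lra.
      apply: (@gap_three_quarters_step 4 3 25 7 _ (16 / 17)) => //; rewrite ?/small_prod; try lra.
      by apply: small_bound_intro; [exact: even_ge4 | left | right | left].
    - have n4 : 4%N \notin ms by apply/negP => /cq.
      apply: (@gap_three_quarters_step 6 3 5 7 _ (18 / 19)) => //; rewrite ?/small_prod; try lra.
      by apply: small_bound_intro; [exact: even_ge6 | left | left | left].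
    - have n4 : 4%N \notin ms by apply/negP => /cq.
      apply: (@gap_three_quarters_step 6 3 5 7 _ (20 / 21)) => //; rewrite ?/small_prod; try lra.
      by apply: small_bound_intro; [exact: even_ge6 | left | left | left].
  - move: gt34; rewrite E (_ : 1 - 1 / 9%:R = 8 / 9 :> R); last by lra.
    exact: gap_three_quarters_9.
  - move: gt34 cq {le2 c_le1}; rewrite E /= => gt34 cq.
    have n4 : 4%N \notin ms by apply/negP => /cq.
    apply: (@gap_three_quarters_step 6 3 5 7 _ (10 / 11)) => //; rewrite ?/small_prod; try lra.
    by apply: small_bound_intro; [exact: even_ge6 | left | left | left].
  - move: gt34 cq {le2 c_le1}; rewrite E /= => gt34 cq.
    have n4 : 4%N \notin ms by apply/negP => /cq.
    apply: (@gap_three_quarters_step 6 3 5 7 _ (12 / 13)) => //; rewrite ?/small_prod; try lra.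
    by apply: small_bound_intro; [exact: even_ge6 | left | left | left].
- by move: gt34; rewrite E; lra.
- move: gt34 {le2 c_le1 cq}; rewrite E /= => gt34.
  have n3 : 3%N \notin ms by apply/negP => /mersenne_prod_le1in; lra.
  have n4 : 4%N \notin ms by apply/negP => /mersenne_prod_le1in; lra.
  apply: (@gap_three_quarters_step 6 9 5 7 _ (4 / 5)) => //; rewrite ?/small_prod; try lra.
  by apply: small_bound_intro; [exact: even_ge6 | right | left | left].
- move: gt34 {le2 c_le1 cq}; rewrite E /= => gt34.
  have n3 : 3%N \notin ms by apply/negP => /mersenne_prod_le1in; lra.
  apply: (@gap_three_quarters_step 4 9 5 7 _ (6 / 7)) => //; rewrite ?/small_prod; try lra.
  by apply: small_bound_intro; [exact: even_ge4 | right | left | left].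
Qed.

End Gaps.

(** * Limits *)

From mathcomp Require Import all_classical all_reals all_analysis.
Import Order.TTheory GRing.Theory Num.Theory.
Import numFieldNormedType.Exports.

Local Open Scope classical_set_scope.
Local Open Scope ring_scope.

(** * Infinite products over the primes *)

Section PrimeProducts.

Variable R : realType.

Definition prime_pprod (k N : nat) : R := \prod_(k <= p < N | prime p) (1 - 1 / 2 ^+ p).

Lemma prime_pprodE k N :
  prime_pprod k N = mersenne_prod R [seq p <- index_iota k N | prime p].
Proof. by rewrite /prime_pprod /mersenne_prod big_filter. Qed.

Lemma prime_pprod_ge0 k N : 0 <= prime_pprod k N.
Proof. by rewrite prime_pprodE mersenne_prod_ge0. Qed.

Lemma prime_pprod_gt0 k N : 0 < prime_pprod k N.
Proof. by apply: prodr_gt0 => p /prime_gt0; apply: mersenne_factor_gt0. Qed.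

Lemma prime_pprod_le1 k N : prime_pprod k N <= 1.
Proof. by rewrite prime_pprodE mersenne_prod_le1. Qed.

Lemma prime_pprod_split k l N : (k <= l <= N)%N ->
  prime_pprod k N = prime_pprod k l * prime_pprod l N.
Proof. by move=> /andP[kl lN]; rewrite /prime_pprod (big_cat_nat kl lN). Qed.

Lemma prime_pprodS k N : (k <= N)%N -> prime_pprod k N.+1 =
  prime_pprod k N * (if prime N then 1 - 1 / 2 ^+ N else 1).
Proof. by move=> le_kN; rewrite /prime_pprod big_mkcond big_nat_recr //= -big_mkcond. Qed.

Lemma prime_pprod_nonincreasing k : nonincreasing_seq (prime_pprod k).
Proof.
move=> M N le_MN; have [le_kM | lt_Mk] := leqP k M.
  by rewrite (prime_pprod_split (l := M)) ?le_kM // ler_piMr ?prime_pprod_ge0 ?prime_pprod_le1.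
by rewrite [leRHS]/prime_pprod big_geq ?prime_pprod_le1 // ltnW.
Qed.

Lemma cvg_prime_pprod k : prime_pprod k @ \oo --> prime_prod R k.
Proof.
apply: nonincreasing_is_cvgn; first exact: prime_pprod_nonincreasing.
by exists 0 => _ [N _ <-]; apply: prime_pprod_ge0.
Qed.

Lemma prime_prod_le k N : prime_prod R k <= prime_pprod k N.
Proof.
apply: nonincreasing_cvgn_ge; first exact: prime_pprod_nonincreasing.
by apply/cvg_ex; exists (prime_prod R k); apply: cvg_prime_pprod.
Qed.

(** A prime beyond [k] and [N] contributes a further factor below 1. *)
Lemma prime_prod_lt k N : prime_prod R k < prime_pprod k N.
Proof.
have [p lt_p p_pr] := prime_above (maxn k N).
have [lt_kp lt_Np] : (k < p)%N /\ (N < p)%N by move: lt_p; rewrite gtn_max => /andP[].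
apply: le_lt_trans (prime_prod_le k p.+1) _.
apply: lt_le_trans (prime_pprod_nonincreasing k (ltnW lt_Np)).
rewrite prime_pprodS ?(ltnW lt_kp) // p_pr.
rewrite gtr_pMr ?prime_pprod_gt0 // gtrBl divr_gt0 ?exprn_gt0 //.
Qed.

Lemma prime_prod_ge0 k : 0 <= prime_prod R k.
Proof.
apply: limr_ge; last by apply: nearW => N; apply: prime_pprod_ge0.
by apply/cvg_ex; exists (prime_prod R k); apply: cvg_prime_pprod.
Qed.

Lemma prime_prod_le1 k : prime_prod R k <= 1.
Proof. exact: le_trans (prime_prod_le k 0) (prime_pprod_le1 k 0). Qed.

Lemma prime_prod_split k l : (k <= l)%N ->
  prime_prod R k = prime_pprod k l * prime_prod R l.
Proof.
move=> le_kl; apply: (@cvg_unique _ _ (prime_pprod k @ \oo)) => //; first exact: cvg_prime_pprod.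
apply: (@cvg_trans _ ((fun N => prime_pprod k l * prime_pprod l N) @ \oo)); last first.
  by apply: cvgMr; apply: cvg_prime_pprod.
apply: near_eq_cvg; near=> N; have le_lN : (l <= N)%N by near: N; exists l.
by rewrite -prime_pprod_split ?le_kl.
Unshelve. all: by end_near. Qed.

Lemma prime_pprod_tail k N : 1 - 2 / 2 ^+ k <= prime_pprod k N.
Proof.
(* The left side is 1 minus the sum of 2^-p over all p from k to k + n - 1, a form that passes
   through the induction. *)
suff tail n : 1 - 2 / 2 ^+ k + 2 / 2 ^+ (k + n) <= prime_pprod k (k + n).
  have le1 : 1 - 2 / 2 ^+ k <= 1 - 2 / 2 ^+ k + 2 / 2 ^+ (k + N) :> R.
    by rewrite lerDl divr_ge0 ?exprn_ge0.
  by apply: le_trans le1 (le_trans (tail N) _); apply/prime_pprod_nonincreasing/leq_addl.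
elim: n => [|n IHn]; first by rewrite addn0 /prime_pprod big_geq // subrK.
rewrite addnS prime_pprodS ?leq_addr //.
have := prime_pprod_le1 k (k + n); have := prime_pprod_ge0 k (k + n).
have : 2 / 2 ^+ (k + n).+1 = 1 / 2 ^+ (k + n) :> R.
  by rewrite exprS invfM mulrA divff ?mul1r.
have : 0 <= 1 / 2 ^+ (k + n) :> R by rewrite divr_ge0 ?exprn_ge0.
move: IHn; have -> : 2 / 2 ^+ (k + n) = 1 / 2 ^+ (k + n) *+ 2 :> R by rewrite mul1r -[RHS]mulr_natl.
move: (1 / 2 ^+ (k + n)) (prime_pprod _ _) (2 / 2 ^+ k) => e x t IH e_ge0 -> x_ge0 x_le1.
case: ifP => _; nra.
Qed.

Lemma prime_prod_ge_tail k : 1 - 2 / 2 ^+ k <= prime_prod R k.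
Proof.
apply: limr_ge; last by apply: nearW => N; apply: prime_pprod_tail.
by apply/cvg_ex; exists (prime_prod R k); apply: cvg_prime_pprod.
Qed.

Lemma prime_pprod_0_11 : prime_pprod 0 11 = small_prod R 2 3 5 7.
Proof.
by rewrite prime_pprodE /mersenne_prod /= !big_cons big_nil mulr1 /small_prod !mulrA.
Qed.

Lemma rho0E : rho0 R = 4 / 5 * small_prod R 2 3 5 7 * prime_prod R 11.
Proof. by rewrite /rho0 (@prime_prod_split 0 11) // prime_pprod_0_11 mulrA. Qed.

Lemma rho1E : rho1 R = 8 / 9 * small_prod R 8 3 5 49 * prime_prod R 11.
Proof.
rewrite /rho1 !big_cons big_nil mulr1 /small_prod; congr (_ * _ * _).
by rewrite [LHS]mulrA [LHS]mulrCA !mulrA.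
Qed.

(** With the primes up to 31 split off, the remaining tail differs from 1 by at most 2^-36, precise
    enough for nine decimals. *)
Lemma prime_prod_11 : prime_prod R 11 =
  (1 - 1 / 2 ^+ 11) * (1 - 1 / 2 ^+ 13) * (1 - 1 / 2 ^+ 17) * (1 - 1 / 2 ^+ 19) *
  (1 - 1 / 2 ^+ 23) * (1 - 1 / 2 ^+ 29) * (1 - 1 / 2 ^+ 31) * prime_prod R 37.
Proof.
rewrite (@prime_prod_split 11 37) //; congr (_ * _).
by rewrite prime_pprodE /mersenne_prod /= !big_cons big_nil mulr1 !mulrA.
Qed.

Lemma rho0_bounds :
  504 / 1000 + 307 / 1000 ^+ 2 + 524 / 1000 ^+ 3 <= rho0 R
        < 504 / 1000 + 307 / 1000 ^+ 2 + 525 / 1000 ^+ 3.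
Proof.
rewrite rho0E prime_prod_11 /small_prod.
have := prime_prod_le1 37; have := prime_prod_ge_tail 37.
move: (prime_prod R 37) => t; rewrite -mulrA; move=> ge le.
apply/andP; split; lra.
Qed.

Lemma rho1_bounds :
  750 / 1000 + 63 / 1000 ^+ 2 + 685 / 1000 ^+ 3 <= rho1 R
        < 750 / 1000 + 63 / 1000 ^+ 2 + 686 / 1000 ^+ 3.
Proof.
rewrite rho1E prime_prod_11 /small_prod.
have := prime_prod_le1 37; have := prime_prod_ge_tail 37.
move: (prime_prod R 37) => t; move=> ge le.
apply/andP; split; lra.
Qed.

End PrimeProducts.

(** * Cycle ratios as products, and the two gaps for them *)

Section CycleRatios.

Variable R : realType.

Lemma card_group_gt0 (gT : finGroupType) : (0 < #|gT|)%N.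
Proof. by apply/card_gt0P; exists 1%g. Qed.

Lemma im_cycle_ratio_sub : im_cycle_ratio R `<=` `]0, 1].
Proof.
move=> _ [gT [a _ ->]]; rewrite /cycle_ratio /= in_itv /=.
have := max_cycle_length_gt0 a (1%g : gT); have := max_cycle_length_le_card a.
have := card_group_gt0 gT => gT_gt0 le gt0.
by rewrite divr_gt0 ?ltr0n //= ler_pdivrMr ?ltr0n // mul1r ler_nat.
Qed.

Lemma pred_ratio q : (0 < q)%N -> q.-1%:R / q%:R = 1 - 1 / q%:R :> R.
Proof. by move=> q_gt0; rewrite -subn1 natrB // mulrBl divff ?pnatr_eq0 -?lt0n. Qed.

Lemma order_ratio_prod (s : seq nat) : all (fun q => 0 < q)%N s ->
  (\prod_(q <- s) q.-1)%:R / (\prod_(q <- s) q)%:R = \prod_(q <- s) (1 - 1 / q%:R) :> R.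
Proof.
elim: s => [_|q s IHs /= /andP[q_gt0 s_gt0]]; first by rewrite !big_nil divr1.
by rewrite !big_cons !natrM -IHs // -pred_ratio // invfM mulrACA.
Qed.

Lemma mersenne_orders_prod ms :
  \prod_(q <- map (expn 2) ms) (1 - 1 / q%:R) = mersenne_prod R ms.
Proof. by rewrite big_map; apply: eq_bigr => m _; rewrite natrX. Qed.

Lemma im_cycle_ratio_gt_half rho : im_cycle_ratio R rho -> 1 / 2 < rho ->
  exists ms c, [/\ coprime_exponents ms, cofactor ms c & rho = c * mersenne_prod R ms].
Proof.
case=> gT [a aA ->] gt_half; have gT_gt0 := card_group_gt0 gT.
have lt_card : (#|gT| < 2 * max_cycle_length a)%N.
  move: gt_half; rewrite /cycle_ratio ltr_pdivlMr ?ltr0n // -(ltr_nat R) natrM.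
  by move: (max_cycle_length a)%:R #|gT|%:R => l n; lra.
have [s [ppq cs eqs]] := large_cycle_orders aA lt_card.
have s_gt0 : all (fun q => 0 < q)%N s by apply/allP => q /ppq[q_gt2 _]; lia.
have rhoE : cycle_ratio R a = \prod_(q <- s) (1 - 1 / q%:R).
  rewrite -order_ratio_prod // /cycle_ratio; apply/eqP.
  have prod_gt0 : (0 < \prod_(q <- s) q)%N.
    by rewrite big_seq; apply: prodn_cond_gt0 => q /(allP s_gt0).
  rewrite eqr_div ?pnatr_eq0 -?lt0n //.
  by rewrite -!natrM eqs mulnC.
have ppq' q : q \in s -> (2 < q)%N /\ exists p k, prime p /\ q = (p ^ k)%N.
  by case/ppq=> q_gt2 [p [k [p_pr _ qE]]]; split=> //; exists p, k.
have [ms wf eq_s] := split_coprime_orders ppq' cs.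
exists ms; rewrite rhoE; case: eq_s => [eq_s | [q0 [odd_q0 q0_gt2 eq_s cq0]]].
  by exists 1; split=> //; [left | rewrite mul1r (perm_big _ eq_s) /= mersenne_orders_prod].
exists (1 - 1 / q0%:R); split=> //; first by right; exists q0.
by rewrite (perm_big _ eq_s) big_cons mersenne_orders_prod.
Qed.

Lemma gap_rho0 rho : im_cycle_ratio R rho -> 1 / 2 < rho -> rho0 R < rho.
Proof.
move=> im_rho gt_half; have [ms [c [wf cof rhoE]]] := im_cycle_ratio_gt_half im_rho gt_half.
rewrite rho0E rhoE; rewrite rhoE in gt_half.
exact: (gap_half wf (prime_prod_ge0 R 11) (prime_prod_lt R 11) cof gt_half).
Qed.

Lemma gap_rho1 rho : im_cycle_ratio R rho -> 3 / 4 < rho -> rho1 R < rho.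
Proof.
move=> im_rho gt34; have [|ms [c [wf cof rhoE]]] := im_cycle_ratio_gt_half im_rho; first by lra.
rewrite rho1E rhoE; rewrite rhoE in gt34.
exact: (gap_three_quarters wf (prime_prod_ge0 R 11) (prime_prod_lt R 11) cof gt34).
Qed.

Lemma im_cycle_ratio_orders (s : seq nat) :
  (forall q, q \in s -> prime_power q) ->
  pairwise (fun q q' => coprime q.-1 q'.-1) s ->
  im_cycle_ratio R (\prod_(q <- s) (1 - 1 / q%:R)).
Proof.
move=> ppq cs; have [gT [a [aA cardT maxT]]] := realize_orders ppq cs.
exists gT, a => //; rewrite /cycle_ratio maxT cardT order_ratio_prod //.
by apply/allP => q /ppq[p [k [p_pr _ ->]]]; rewrite expn_gt0 prime_gt0.
Qed.

Lemma im_cycle_ratio_mersenne p k ms : prime p -> (0 < k)%N ->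
  (forall m, coprime (p ^ k).-1 (2 ^ m.+1).-1) -> coprime_exponents ms ->
  im_cycle_ratio R ((1 - 1 / (p ^ k)%:R) * mersenne_prod R ms).
Proof.
move=> p_pr k_gt0 cpk wf; rewrite -mersenne_orders_prod.
rewrite -(big_cons _ _ (p ^ k)%N _ xpredT (fun q : nat => 1 - 1 / q%:R)).
have gt1 := coprime_exponents_gt1 wf.
apply: im_cycle_ratio_orders.
  move=> q; rewrite inE => /orP[/eqP-> | /mapP[m ms_m ->]]; first by exists p, k.
  by exists 2%N, m; split=> //; apply: ltnW; apply: gt1.
rewrite /=; apply/andP; split.
  by apply/allP => _ /mapP[m /gt1 m_gt1 ->]; rewrite -(ltn_predK m_gt1).
rewrite pairwise_map; case/andP: wf => _.
apply: (@sub_in_pairwise _ (mem ms)); last by apply/allP.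
by move=> m n ms_m ms_n /= co; rewrite coprime_pred_expn2 // ltnW ?gt1.
Qed.

Lemma coprime_pow2_pred_expn2 k m : coprime (2 ^ k) (2 ^ m.+1).-1.
Proof.
by rewrite coprimeXl // coprime2n odd_pred_expn2.
Qed.

Lemma coprime_exponents_primes k N : coprime_exponents [seq p <- index_iota k N | prime p].
Proof.
apply/andP; split.
  by apply/allP => p; rewrite mem_filter => /andP[/prime_gt1].
apply: (@sub_in_pairwise _ (fun p => prime p) [rel p q | p != q]).
- by move=> p q p_pr q_pr /= ne; rewrite prime_coprime // dvdn_prime2.
- by apply/allP => p; rewrite mem_filter => /andP[].
by rewrite -uniq_pairwise filter_uniq ?iota_uniq.
Qed.

End CycleRatios.

(** * Infima, density and limit points of the set of ratios *)

Section LimitPoints.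

Variable R : realType.

Lemma im_cycle_ratio_rho0 N : im_cycle_ratio R (4 / 5 * prime_pprod R 0 N).
Proof.
have -> : 4 / 5 = 1 - 1 / (5 ^ 1)%:R :> R by rewrite expn1; lra.
rewrite prime_pprodE; apply: im_cycle_ratio_mersenne => // [m|].
  (* 5 - 1 is a power of 2, hence coprime to every 2^m - 1 with m > 0. *)
  exact: (coprime_pow2_pred_expn2 2).
exact: coprime_exponents_primes.
Qed.

Lemma coprime_exponents_rho1 N :
  coprime_exponents ([:: 3; 5; 8; 49]%N ++ [seq p <- index_iota 11 N | prime p]).
Proof.
have /andP[gt1 co] := coprime_exponents_primes 11 N.
rewrite /coprime_exponents all_cat gt1 pairwise_cat co /= !andbT.
have cop p : p \in [seq p <- index_iota 11 N | prime p] -> forall k, (0 < k < 11)%N -> coprime k p.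
  rewrite mem_filter mem_index_iota => /and3P[p_pr p_ge _] k /andP[k_gt0 k_lt].
  rewrite coprime_sym prime_coprime //; apply/negP => /dvdn_leq le; lia.
by rewrite !allrel_consl allrel0l /= !andbT; apply/and4P; split; apply/allP => p /cop cp;
  rewrite ?(coprimeXl 2 (_ : coprime 7 p)) ?cp.
Qed.

Lemma im_cycle_ratio_rho1 N :
  im_cycle_ratio R (8 / 9 * small_prod R 8 3 5 49 * prime_pprod R 11 N).
Proof.
have -> : 8 / 9 * small_prod R 8 3 5 49 * prime_pprod R 11 N =
   (1 - 1 / (3 ^ 2)%:R) * mersenne_prod R ([:: 3; 5; 8; 49]%N ++
     [seq p <- index_iota 11 N | prime p]).
  rewrite mersenne_prod_cat prime_pprodE [RHS]mulrA; congr (_ * _); congr (_ * _).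
    by rewrite (_ : (3 ^ 2 = 9)%N) //; lra.
  rewrite /mersenne_prod !big_cons big_nil mulr1 /small_prod.
  by rewrite [RHS]mulrA [RHS]mulrCA !mulrA.
apply: im_cycle_ratio_mersenne => // [m|].
  (* Similarly 9 - 1 = 2^3. *)
  exact: (coprime_pow2_pred_expn2 3).
exact: coprime_exponents_rho1.
Qed.

Lemma cvg_rho0 : 4 / 5 * prime_pprod R 0 N @[N --> \oo] --> rho0 R.
Proof. by apply: cvgMr; apply: cvg_prime_pprod. Qed.

Lemma cvg_rho1 : 8 / 9 * small_prod R 8 3 5 49 * prime_pprod R 11 N @[N --> \oo] --> rho1 R.
Proof. by rewrite rho1E; apply: cvgMr; apply: cvg_prime_pprod. Qed.

Lemma rho0_lt N : rho0 R < 4 / 5 * prime_pprod R 0 N.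
Proof. by rewrite ltr_pM2l ?prime_prod_lt //; lra. Qed.

Lemma small_prod_gt0 b2 b3 b5 b7 : (0 < b2)%N -> (0 < b3)%N -> (0 < b5)%N -> (0 < b7)%N ->
  0 < small_prod R b2 b3 b5 b7.
Proof. by move=> *; rewrite !mulr_gt0 ?mersenne_factor_gt0. Qed.

Lemma rho1_lt N : rho1 R < 8 / 9 * small_prod R 8 3 5 49 * prime_pprod R 11 N.
Proof. by rewrite rho1E ltr_pM2l ?prime_prod_lt // mulr_gt0 ?small_prod_gt0 //; lra. Qed.

Lemma small_prod_le1 b2 b3 b5 b7 : small_prod R b2 b3 b5 b7 <= 1.
Proof. by rewrite !mulr_ile1 ?mulr_ge0 ?mersenne_factor_ge0 ?mersenne_factor_le1. Qed.

Lemma inf_limit (A : set R) r (v : nat -> R) :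
  (forall x, A x -> r <= x) -> (forall n, A (v n)) -> v @ \oo --> r -> inf A = r.
Proof.
move=> lbA Av cv; apply/eqP; rewrite eq_le; apply/andP; split; last first.
  by apply: lb_le_inf; [exists (v 0%N) | apply: lbA].
rewrite -(cvg_lim _ cv) //; apply: limr_ge; first by apply/cvg_ex; exists r.
by apply: nearW => n; apply: ge_inf => //; exists r; apply: lbA.
Qed.

Lemma inf_rho0 : inf (im_cycle_ratio R `&` `]rho0 R, 1[) = rho0 R.
Proof.
apply: (inf_limit _ _ cvg_rho0) => [x [_]|N] /=.
  by rewrite in_itv /= => /andP[/ltW].
split; first exact: im_cycle_ratio_rho0.
rewrite /= in_itv /= rho0_lt /=; have := prime_pprod_le1 R 0 N; lra.
Qed.

Lemma inf_rho1 : inf (im_cycle_ratio R `&` `]rho1 R, 1[) = rho1 R.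
Proof.
apply: (inf_limit _ _ cvg_rho1) => [x [_]|N] /=.
  by rewrite in_itv /= => /andP[/ltW].
split; first exact: im_cycle_ratio_rho1.
rewrite /= in_itv /= rho1_lt /=.
have small_ge0 : 0 <= small_prod R 8 3 5 49 by rewrite ltW ?small_prod_gt0.
have le1 := mulr_ile1 small_ge0 (prime_pprod_ge0 R 11 N) (small_prod_le1 8 3 5 49)
  (prime_pprod_le1 R 11 N).
rewrite -mulrA; lra.
Qed.

Lemma not_dense : ~ (`]0, 1] `<=` closure (im_cycle_ratio R)).
Proof.
have /andP[ge_rho0 _] := rho0_bounds R => dense.
(* A point with a neighborhood inside the gap between 1/2 and [rho0 R]. *)
have : closure (im_cycle_ratio R) (502 / 1000) by apply: dense; rewrite /= in_itv /=; lra.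
have mid : (502 / 1000 : R) \in `]1 / 2, 504 / 1000[ by rewrite in_itv /=; lra.
move=> /(_ _ (near_in_itvoo mid))[x [im_x]] /=; rewrite in_itv /= => /andP[/(gap_rho0 im_x)].
lra.
Qed.

(** The number [rho0 R] is a limit of ratios, but [gap_rho0] keeps it from being one itself. *)
Lemma not_closed : ~ closed_in (`]0, 1] : set R) (im_cycle_ratio R).
Proof.
have /andP[ge_rho0 lt_rho0] := rho0_bounds R.
move/closed_subspaceP=> [V clV VE].
have im_V x : im_cycle_ratio R x -> V x.
  move=> im_x; have : (im_cycle_ratio R `&` `]0, 1]) x by split=> //; apply: im_cycle_ratio_sub.
  by rewrite -VE => -[].
have V_rho0 : V (rho0 R).
  have nearV : \forall N \near \oo, V (4 / 5 * prime_pprod R 0 N).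
    by apply: nearW => N; apply/im_V/im_cycle_ratio_rho0.
  exact: closed_cvg clV nearV _ cvg_rho0.
have : (V `&` `]0, 1]) (rho0 R) by split=> //; rewrite /= in_itv /=; lra.
rewrite VE => -[im_rho0 _]; have gt_half : 1 / 2 < rho0 R by lra.
by have := gap_rho0 im_rho0 gt_half; rewrite ltxx.
Qed.

(** Taking the product with a field automorphism of order-2^m type multiplies the ratio by 1 - 1 /
    2^m, provided 2^m - 1 is coprime to the given cycle length. *)
Lemma approximable rho : im_cycle_ratio R rho ->
  exists (G : nat -> finGroupType) (alpha : forall n, {perm (G n)}),
        [/\ forall n, alpha n \in Aut [set: G n]%G,
            forall n, cycle_ratio R (alpha n) < rho &
            cycle_ratio R (alpha n) @[n --> \oo] --> rho].
Proof.
move=> im_rho; have /im_cycle_ratio_sub := im_rho; rewrite /= in_itv /= => /andP[rho_gt0 _].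
case: im_rho => gT [a aA rhoE].
have l_gt0 := max_cycle_length_gt0 a (1%g : gT).
(* Exponents of the form required by [coprime_pred_expn2_totient]; they exceed [n], so the new
   factor tends to 1. *)
pose m n := (n.+1 * totient (max_cycle_length a)`_(2^')).+1%N.
(* Group and permutation are packed into one dependent pair so that [choice] can select both at
   once. *)
have step n : exists X : {gT : finGroupType & {perm gT}},
    tagged X \in Aut [set: tag X]%G /\ cycle_ratio R (tagged X) = rho * (1 - 1 / 2 ^+ m n).
  have pp : prime_power (2 ^ m n) by exists 2%N, (m n).
  have [F [b [bA cardF maxb]]] := field_automorphism pp.
  have [|gT2 [a2 [aA2 cardT2 maxT2]]] := product_automorphism aA bA.
    by rewrite maxb coprime_pred_expn2_totient.
  exists (Tagged (fun gT : finGroupType => {perm gT}) a2); split=> //=.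
  rewrite rhoE /cycle_ratio cardT2 maxT2 cardF maxb !natrM invfM mulrACA; congr (_ * _).
  by rewrite pred_ratio ?expn_gt0 // natrX.
have [X XP] := choice step.
exists (fun n => tag (X n)), (fun n => tagged (X n)); split=> [n|n|].
- by have [] := XP n.
- have [_ ->] := XP n.
  by rewrite gtr_pMr // gtrBl divr_gt0 ?exprn_gt0.
have -> : (fun n => cycle_ratio R (tagged (X n))) = (fun n => rho * (1 - 1 / 2 ^+ m n)).
  by apply/funext => n; have [] := XP n.
rewrite -[X in _ --> X]mulr1; apply: cvgMr.
apply: (@squeeze_cvgr _ _ _ _ (fun n => 1 - 1 / 2 ^+ n) (fun=> 1)).
- apply: nearW => n; rewrite mersenne_factor_le1 andbT mersenne_factor_le //.
  by rewrite /m ltnW // ltnS (leq_trans (leqnSn n)) // leq_pmulr // totient_gt0 part_gt0.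
- rewrite -[X in _ --> X]subr0; apply: cvgB; first exact: cvg_cst.
  have -> : (fun n => 1 / 2 ^+ n) = (fun n => (1 / 2) ^+ n) :> (nat -> R).
    by apply/funext => n; rewrite expr_div_n expr1n.
  by apply: cvg_expr; rewrite ger0_norm; lra.
exact: cvg_cst.
Qed.

Lemma no_isolated : isolated (im_cycle_ratio R) = set0.
Proof.
apply/seteqP; split=> // x [/set_mem im_x [V nV VE]].
have [G [alpha [alphaA lt_x cvg_x]]] := approximable im_x.
have [N _ VN] := cvg_x V nV; have := VN N (leqnn N).
have im_N : im_cycle_ratio R (cycle_ratio R (alpha N)) by exists (G N), (alpha N).
move=> V_N; have : (V `&` im_cycle_ratio R) (cycle_ratio R (alpha N)) by [].
by rewrite VE => /= eq_x; have := lt_x N; rewrite eq_x ltxx.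
Qed.

End LimitPoints.

Theorem theorem1p1p10 (R : realType) :
  [/\ im_cycle_ratio R `<=` `]0, 1],
      504 / 1000 + 307 / 1000 ^+ 2 + 524 / 1000 ^+ 3 <= rho0 R
        < 504 / 1000 + 307 / 1000 ^+ 2 + 525 / 1000 ^+ 3 &
      750 / 1000 + 63 / 1000 ^+ 2 + 685 / 1000 ^+ 3 <= rho1 R
        < 750 / 1000 + 63 / 1000 ^+ 2 + 686 / 1000 ^+ 3] /\
  ((forall rho : R, im_cycle_ratio R rho ->
      exists (G : nat -> finGroupType) (alpha : forall n, {perm (G n)}),
        [/\ forall n, alpha n \in Aut [set: G n]%G,
            forall n, cycle_ratio R (alpha n) < rho &
            cycle_ratio R (alpha n) @[n --> \oo] --> rho]) /\
   isolated (im_cycle_ratio R) = set0) /\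
  [/\ im_cycle_ratio R `&` `]1 / 2, rho0 R] = set0,
      ~ (`]0, 1] `<=` closure (im_cycle_ratio R)),
      inf (im_cycle_ratio R `&` `]rho0 R, 1[) = rho0 R &
      ~ closed_in (`]0, 1] : set R) (im_cycle_ratio R)] /\
  (im_cycle_ratio R `&` `]3 / 4, rho1 R] = set0 /\
   inf (im_cycle_ratio R `&` `]rho1 R, 1[) = rho1 R).
Proof.
split; first by split; [exact: im_cycle_ratio_sub | exact: rho0_bounds | exact: rho1_bounds].
split; first by split; [exact: approximable | exact: no_isolated].
split.
  split; [|exact: not_dense|exact: inf_rho0|exact: not_closed].
  apply/seteqP; split=> // x [im_x] /=; rewrite in_itv /= => /andP[/(gap_rho0 im_x) lt le].
  by have := lt_le_trans lt le; rewrite ltxx.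
split; last exact: inf_rho1.
apply/seteqP; split=> // x [im_x] /=; rewrite in_itv /= => /andP[/(gap_rho1 im_x) lt le].
by have := lt_le_trans lt le; rewrite ltxx.
Qed.
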